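(* Let $R>0$, let $\mu$ be a finite (non-negative) Borel measure on $\mathbb{R}^n$ with support in $\overline{B_R}=\{x:|x|\le R\}$, and let $P$ be a polynomial on $\mathbb{R}^n$. Then $\mu$ has support in $P^{-1}\{0\}=\{x\in\mathbb{R}^n:P(x)=0\}$ if and only if $$P(\zeta\theta)\,\widehat{\mu}(\zeta,\theta)=Q_P(\zeta,\theta)\quad\text{for all }\theta\in\mathbb{S}^{n-1}\text{ and all }\zeta\in\mathbb{C}\text{ with }|\zeta|>R.$$
   Context: Polynomials have complex coefficients and are evaluated at complex points $\zeta\theta\in\mathbb{C}^n$ in the obvious way. $\mathbb{S}^{n-1}$ is the unit sphere of $\mathbb{R}^n$ and $\omega_n$ its surface area. For $\theta\in\mathbb{S}^{n-1}$ and $|x|\le R$, $\zeta\mapsto r(\zeta\theta-x)$ denotes the analytic continuation to $\{\zeta\in\mathbb{C}:|\zeta|>R\}$ of $\rho\mapsto|\rho\theta-x|$, $\rho>R$; it has no zeros there and satisfies $r(\zeta\theta-x)^2=\zeta^2-2\zeta\langle\theta,x\rangle+|x|^2$. The multivariate Markov transform of $\mu$ is $$\widehat{\mu}(\zeta,\theta)=\frac1{\omega_n}\int_{\mathbb{R}^n}\frac{\zeta^{n-1}}{r(\zeta\theta-x)^n}\,d\mu(x),\qquad |\zeta|>R,\ \theta\in\mathbb{S}^{n-1},$$ and the function of the second kind with respect to $P$ (and $\mu$) is $$Q_P(\zeta,\theta)=\frac1{\omega_n}\int_{\mathbb{R}^n}\frac{P(\zeta\theta)-P(x)}{r(\zeta\theta-x)^n}\,\zeta^{n-1}\,d\mu(x),\qquad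 |\zeta|>R,\ \theta\in\mathbb{S}^{n-1}.$$ *)

(* Defs.v *)
From HB Require Import structures.
From mathcomp Require Import all_boot all_order all_algebra.
From mathcomp Require Import all_classical all_reals all_analysis.
From mathcomp Require Import complex.
From mathcomp Require mpoly.

Set Implicit Arguments.
Unset Strict Implicit.
Unset Printing Implicit Defensive.

Import Order.TTheory GRing.Theory Num.Theory.
Import numFieldNormedType.Exports.

Local Open Scope classical_set_scope.
Local Open Scope complex_scope.
Local Open Scope ring_scope.

(* R^n with its Borel sigma-algebra *)
Notation borelRn R n := (g_sigma_algebraType (@open 'rV[R]_n)).

Section euclidean.
Variables (R : realType) (n : nat).
Implicit Types x : 'rV[R]_n.

(* The library norm on row vectors is the sup norm. *)
Definition enorm x : R := Num.sqrt (\sum_i x 0 i ^+ 2).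

Definition cball (rad : R) : set 'rV[R]_n := [set x | enorm x <= rad].

Definition sphere : set 'rV[R]_n := [set x | enorm x = 1].

Definition msupport (mu : set (borelRn R n) -> \bar R) : set 'rV[R]_n :=
  [set x | forall U : set 'rV[R]_n, open U -> U x -> (0 < mu U)%E].

Definition lebesgue_outer (A : set 'rV[R]_n) : \bar R :=
  ereal_inf [set v | exists a b : nat -> 'rV[R]_n,
    [/\ forall k i, a k 0 i <= b k 0 i,
        A `<=` \bigcup_k [set x | forall i, a k 0 i < x 0 i < b k 0 i] &
        v = (\sum_(0 <= k <oo) (\prod_i (b k 0 i - a k 0 i))%:E)%E]].

(* Surface measure on the unit sphere, as in polar coordinates: n times the
   volume of the part of the unit ball lying under A. *)
Definition surface_area (A : set 'rV[R]_n) : R :=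
  n%:R * fine (lebesgue_outer
    [set x | exists (t : R) theta, [/\ 0 < t < 1, A theta & x = t *: theta]]).

(* Equal to 2 when n = 1, and to 2 * pi when n = 2. *)
Definition omega : R := surface_area sphere.

End euclidean.

Section complex_analysis.
Variable R : realType.
Local Notation C := R[i].

Definition analytic_on (D : set C) (f : C -> C) : Prop :=
  forall c, D c -> exists a : nat -> C, exists2 e : R, 0 < e &
    forall z, `|z - c| < e%:C ->
      series (fun k => a k * (z - c) ^+ k) @ \oo --> (f z : C^o).

Definition Cintegral d (T : measurableType d)
    (mu : {measure set T -> \bar R}) (D : set T) (f : T -> C) : C :=
  Rintegral mu D (fun x => complex.Re (f x)) +i* Rintegral mu D (fun x => complex.Im (f x)).

End complex_analysis.

Section markov.
Variables (R : realType) (n : nat) (rad : R).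
Local Notation C := R[i].
Implicit Types (x theta : 'rV[R]_n) (zeta : C).

Definition exterior : set C := [set zeta | rad%:C < `|zeta|].

Definition is_continuation theta x (f : C -> C) : Prop :=
  analytic_on exterior f /\
  (forall rho : R, rad < rho -> f rho%:C = (enorm (rho *: theta - x))%:C).

(* The analytic continuation to |zeta| > rad of rho |-> |rho theta - x|. It
   exists for |theta| = 1 and |x| <= rad, and is unique there. *)
Definition rcont zeta theta x : C :=
  xget (fun=> 0) (is_continuation theta x) zeta.

Definition evalR (P : mpoly.mpoly n C) x : C :=
  mpoly.meval (fun i => (x 0 i)%:C) P.

Definition evalC (P : mpoly.mpoly n C) zeta theta : C :=
  mpoly.meval (fun i => zeta * (theta 0 i)%:C) P.

Variable mu : {measure set (borelRn R n) -> \bar R}.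

(* In the next two definitions, the integrand is defined only for |x| <= rad:
   the integral over R^n is that of its extension by 0, mu being supported in
   this ball. *)
Definition markov_transform zeta theta : C :=
  ((omega R n)%:C)^-1 * Cintegral mu (cball rad)
    (fun x => zeta ^+ n.-1 / rcont zeta theta x ^+ n).

Definition second_kind (P : mpoly.mpoly n C) zeta theta : C :=
  ((omega R n)%:C)^-1 * Cintegral mu (cball rad)
    (fun x => (evalC P zeta theta - evalR P x) / rcont zeta theta x ^+ n
              * zeta ^+ n.-1).

End markov.

(* Main.v *)
Require Import Defs.
From HB Require Import structures.
From mathcomp Require Import all_boot all_order all_algebra.
From mathcomp Require Import all_classical all_reals all_analysis.
From mathcomp Require Import complex.
From mathcomp Require mpoly.
From mathcomp Require Import measurable_realfun.
From mathcomp Require Import ring lra zify.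

(** Since r(zeta theta - x)^2 has no zeros for |x| <= rad < |zeta|, all
    integrands are bounded on the ball and linearity gives
      P mu^ - Q_P = (1 / omega) int P(x) zeta^(n-1) / r(zeta theta - x)^n dmu(x)
    (markov_second_kindB).  The surface area omega is finite and nonzero
    (omega_neq0), so the functional equation says that the integral on the
    right vanishes for all theta and zeta.

    If mu lives on the zero set of P, the integrand is zero almost everywhere,
    because the complement of the support is a null set
    (msupport_compl_negligible).

    Conversely, real zeta suffice.  With y = zeta theta, the hypothesis says
    that the potentials int g(x) / |y - x|^n dmu(x) vanish for all real y with
    |y| > rad, where g is the real or the imaginary part of P.  Such an
    identity may be differentiated in y.  The Laplacian of |y - x|^(-s) is
    s (s + 2 - n) |y - x|^(-s-2), with a nonzero constant when s >= n, so
    raising the exponent by two preserves vanishing (potential0_laplace).  The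
    gradient in turn brings down a factor y_i - x_i, hence a factor x_i
    (potential0_coord).  Therefore int f(x) g(x) / |y - x|^s dmu(x) = 0 for
    every polynomial f and some s (potential0_polyn).  Taking f = g, the
    integrand is nonnegative, so g = 0 almost everywhere and, g being
    continuous, on the whole support.

    Most of the remaining work identifies r.  The function
      zeta * sqrt (1 - 2 <theta, x> / zeta + |x|^2 / zeta^2),
    with the principal square root, is a continuation (rbranch_analytic,
    rbranch_real): the radicand avoids the negative half-line, and the local
    power series of the square root of a quadratic polynomial is obtained from
    its differential equation (sqrt_pseries).  It is the only continuation by
    the identity theorem (continuation_unique).  This formula is what makes
    the integrands measurable and bounded. *)

Set Implicit Arguments.
Unset Strict Implicit.
Unset Printing Implicit Defensive.

Import Order.TTheory GRing.Theory Num.Theory.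
Import numFieldNormedType.Exports.

Local Open Scope classical_set_scope.
Local Open Scope complex_scope.
Local Open Scope ring_scope.

Import Normc.
Local Notation Re := complex.Re.
Local Notation Im := complex.Im.

(** * Complex modulus and convergence *)

Section modulus.
Variable R : realType.
Local Notation C := R[i].
Implicit Types z w : C.

Lemma normE z : `|z| = (normc z)%:C.
Proof. by case: z. Qed.

Lemma normc_ge0 z : 0 <= normc z.
Proof. by rewrite -lecR -normE normr_ge0. Qed.

Lemma normcX z k : normc (z ^+ k) = normc z ^+ k.
Proof. by apply: complexI; rewrite -normE normrX normE rmorphXn. Qed.

Lemma normc_eq0 z : (normc z == 0) = (z == 0).
Proof. by rewrite -(normr_eq0 z) normE (fmorph_eq0 (real_complex R)). Qed.

Lemma normc_gt0 z : (0 < normc z) = (z != 0).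
Proof. by rewrite lt_def normc_ge0 andbT normc_eq0. Qed.

Lemma normc_one : normc (1 : C) = 1.
Proof. by apply: complexI; rewrite -normE normr1. Qed.

Lemma normc_opp z : normc (- z) = normc z.
Proof. by apply: complexI; rewrite -!normE normrN. Qed.

Lemma normcD z w : normc (z + w) <= normc z + normc w.
Proof. by rewrite -lecR rmorphD /= -!normE ler_normD. Qed.

Lemma normcB z w : normc (z - w) <= normc z + normc w.
Proof. by rewrite -(normc_opp w) normcD. Qed.

Lemma normc_ler_distD v z w : normc (z - w) <= normc (z - v) + normc (v - w).
Proof. by rewrite (_ : z - w = (z - v) + (v - w)) ?normcD //; ring. Qed.

Lemma normc_sum (I : Type) (r : seq I) (F : I -> C) :
  normc (\sum_(i <- r) F i) <= \sum_(i <- r) normc (F i).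
Proof.
elim/big_ind2: _ => //; first by rewrite normc0.
by move=> a b c d ? ?; rewrite (le_trans (normcD _ _)) // lerD.
Qed.

Lemma normc_ge_absRe z : `|Re z| <= normc z.
Proof. by rewrite -lecR -normE; exact: normc_ge_Re. Qed.

Lemma ReD (z w : C) : Re (z + w) = Re z + Re w.
Proof. by case: z w => ? ? []. Qed.
Lemma ImD (z w : C) : Im (z + w) = Im z + Im w.
Proof. by case: z w => ? ? []. Qed.
Lemma ReM (z w : C) : Re (z * w) = Re z * Re w - Im z * Im w.
Proof. by case: z w => ? ? []. Qed.
Lemma ImM (z w : C) : Im (z * w) = Re z * Im w + Im z * Re w.
Proof. by case: z w => ? ? []. Qed.
Lemma ReV (z : C) : Re z^-1 = Re z * (Re z ^+ 2 + Im z ^+ 2)^-1.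
Proof. by case: z. Qed.
Lemma ImV (z : C) : Im z^-1 = - (Im z * (Re z ^+ 2 + Im z ^+ 2)^-1).
Proof. by case: z. Qed.
Lemma ReN (z : C) : Re (- z) = - Re z.
Proof. by case: z. Qed.

Lemma normc_real (r : R) : normc r%:C = `|r|.
Proof. by rewrite /= expr0n /= addr0 sqrtr_sqr. Qed.

Lemma normc_sq z : normc z ^+ 2 = Re z ^+ 2 + Im z ^+ 2.
Proof. by case: z => a b /=; rewrite sqr_sqrtr // addr_ge0 ?sqr_ge0. Qed.

Lemma cvgC (u : nat -> C) (l : C) :
  (u @ \oo --> (l : C^o)) <->
  forall e : R, 0 < e -> exists N, forall k, (N <= k)%N -> normc (l - u k) < e.
Proof.
split=> [/(cvgrPdist_lt (K := C) (V := C^o)) ul e e0|ul].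
  have /ul [N _ uN] : 0 < e%:C by rewrite ltcR.
  by exists N => k Nk; rewrite -ltcR -normE; exact: uN.
apply/(cvgrPdist_lt (K := C) (V := C^o)) => e e0.
have eE : e = (Re e)%:C by rewrite RRe_real // gtr0_real.
have [|N uN] := ul (Re e); first by rewrite -ltcR -eE.
by exists N => // k /uN; rewrite -ltcR -normE -eE.
Qed.

End modulus.

(** * Uniqueness of analytic continuation outside a disc *)

Section identity.
Variable R : realType.
Local Notation C := R[i].

Lemma cvgC_bounded (u : nat -> C) (l : C) : u @ \oo --> (l : C^o) ->
  exists2 M : R, 0 < M & forall k, normc (u k) <= M.
Proof.
move=> /cvgC /(_ 1 ltr01) [N uN].
pose S := \sum_(k <- iota 0 N) normc (u k).
have S0 : 0 <= S by rewrite sumr_ge0 // => *; exact: normc_ge0.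
exists (normc l + 1 + S) => [|k]; first by rewrite -addrA ltr_wpDl ?normc_ge0 // ltr_wpDr.
have [Nk|kN] := leqP N k.
  have := uN k Nk; have := normcB l (l - u k); rewrite opprB addrC subrK.
  by move=> ? ?; lra.
have : normc (u k) <= S.
  rewrite /S (big_rem k) /= ?mem_iota // lerDl sumr_ge0 // => *; exact: normc_ge0.
have := normc_ge0 l; lra.
Qed.

(** At half the radius of convergence the terms are differences of bounded
    partial sums. *)
Lemma pseries_bounded_coef (a : nat -> C) (F : C -> C) (e : R) : 0 < e ->
  (forall h : C, `|h| < e%:C ->
    series (fun k => a k * h ^+ k) @ \oo --> (F h : C^o)) ->
  exists2 M : R, 0 < M & forall k, normc (a k) * (e / 2) ^+ k <= M.
Proof.
move=> e0 aF; have e20 : 0 < e / 2 by rewrite divr_gt0.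
have [|M M0 aM] := cvgC_bounded (aF (e / 2)%:C _).
  by rewrite normE normc_real ltcR gtr0_norm // ltr_pdivrMr // ltr_pMr // ltr1n.
exists (M + M) => [|k]; first exact: addr_gt0.
have -> : normc (a k) * (e / 2) ^+ k = normc (a k * (e / 2)%:C ^+ k).
  by rewrite normcM normcX normc_real gtr0_norm.
have -> : a k * (e / 2)%:C ^+ k = series (fun k => a k * (e / 2)%:C ^+ k) k.+1
   - series (fun k => a k * (e / 2)%:C ^+ k) k.
  by rewrite /series /= big_nat_recr //= addrAC subrr add0r.
by rewrite (le_trans (normcB _ _)) // lerD.
Qed.

Lemma geo_tail_le (x : R) m k : 0 <= x <= 1/2 ->
  \sum_(m <= j < m + k) x ^+ j <= 2 * x ^+ m.
Proof.
move=> /andP[x0 x2].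
suff : \sum_(m <= j < m + k) x ^+ j <= 2 * x ^+ m - 2 * x ^+ (m + k).
  by move=> /le_trans; apply; rewrite gerBl mulr_ge0 // exprn_ge0.
elim: k => [|k IH]; first by rewrite addn0 big_geq // subrr.
rewrite addnS big_nat_recr ?leq_addr //= exprS.
by have := exprn_ge0 (m + k) x0; nra.
Qed.

(** Zeros of a power series are isolated: if a k is the first nonzero
    coefficient, near 0 the sum differs from a k h^k by O(h^(k+1)). *)
Lemma pseries_zeros (a : nat -> C) (F : C -> C) (e : R) : 0 < e ->
  (forall h : C, `|h| < e%:C ->
    series (fun k => a k * h ^+ k) @ \oo --> (F h : C^o)) ->
  (forall d : R, 0 < d -> exists h, [/\ h != 0, normc h < d & F h = 0]) ->
  forall k, a k = 0.
Proof.
move=> e0 aF Fz; have [M M0 aM] := pseries_bounded_coef e0 aF.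
elim/ltn_ind => k IH; apply/eqP; rewrite -normc_eq0; apply/negPn/negP => ak0.
have {}ak0 : 0 < normc (a k) by rewrite lt_def ak0 normc_ge0.
pose r := e / 2; have r0 : 0 < r by rewrite /r divr_gt0.
pose K := 2 * M / r ^+ k.+1.
have K0 : 0 < K by rewrite /K divr_gt0 ?mulr_gt0 ?exprn_gt0.
have [|h [h0 hd Fh]] := Fz (Num.min (r / 2) (normc (a k) / (2 * K))).
  by rewrite lt_min !divr_gt0 // mulr_gt0.
move: hd; rewrite lt_min => /andP[hr hK].
have hn0 : 0 < normc h by rewrite normc_gt0.
have he : `|h| < e%:C by rewrite normE ltcR; rewrite /r in hr; lra.
have /cvgC cv := aF h he; rewrite Fh in cv.
have ak_h : 0 < normc (a k) * normc h ^+ k / 2 by rewrite !(mulr_gt0, divr_gt0, exprn_gt0).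
have [N sN] := cv _ ak_h.
have := sN (k.+1 + N)%N (leq_addl _ _).
rewrite sub0r normc_opp /series /= (@big_cat_nat _ _ _ k.+1) //= ?leq_addr //.
rewrite big_nat_recr //= big1_seq ?add0r; last first.
  by move=> i /andP[_]; rewrite mem_index_iota => /andP[_ /IH ->]; rewrite mul0r.
set T := (X in normc (_ + X)) => H.
have TM : normc T <= K * normc h ^+ k.+1.
  rewrite (le_trans (normc_sum _ _)) //.
  apply: (@le_trans _ _ (\sum_(k.+1 <= j < k.+1 + N) M * (normc h / r) ^+ j)).
    apply: ler_sum_nat => j _; rewrite normcM normcX expr_div_n.
    rewrite mulrA [M * _]mulrC -mulrA [normc _ * _]mulrC ler_pM2l ?exprn_gt0 //.
    by rewrite ler_pdivlMr ?exprn_gt0.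
  rewrite -mulr_sumr (_ : K * _ = M * (2 * (normc h / r) ^+ k.+1)); last first.
    rewrite expr_div_n /K; field; rewrite ?expf_neq0 ?gt_eqF //.
  rewrite ler_pM2l //; apply: geo_tail_le; apply/andP; split.
    by rewrite divr_ge0 ?normc_ge0 ?ltW.
  by rewrite ler_pdivrMr //; lra.
have : normc (a k) * normc h ^+ k <= normc (a k * h ^+ k + T) + normc T.
  have := normcB (a k * h ^+ k + T) T; rewrite addrK normcM normcX //.
have {}hK : normc h * (2 * K) < normc (a k) by rewrite -ltr_pdivlMr // mulr_gt0.
move: TM; rewrite exprS => TM H1.
have : normc (a k) * normc h ^+ k / 2 <= K * normc h * normc h ^+ k.
  by rewrite -mulrA; lra.
by rewrite mulrAC ler_pM2r ?exprn_gt0 //; lra.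
Qed.

Definition zero_near (D : C -> C) (c : C) :=
  exists2 e : R, 0 < e & forall z, normc (z - c) < e -> D z = 0.

Lemma zero_near_accumulation (E : set C) (D : C -> C) c :
  analytic_on E D -> E c ->
  (forall d : R, 0 < d -> exists z, [/\ z != c, normc (z - c) < d & D z = 0]) ->
  zero_near D c.
Proof.
move=> aD Ec Dz; have [a [e e0 ae]] := aD c Ec.
have a0 : forall k, a k = 0.
  apply: (@pseries_zeros a (fun h => D (c + h)) e) => // [h he|d d0].
    by have := ae (c + h); rewrite (addrC c) addrK; apply.
  have [z [zc zd Dz0]] := Dz d d0; exists (z - c); split => //.
    by rewrite subr_eq0.
  by rewrite addrC subrK.
exists e => // z; rewrite -ltcR -normE => /ae /cvgC cv.
apply/eqP; rewrite -normc_eq0; apply/negPn/negP => nD.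
have [|N /(_ N (leqnn _))] := cv (normc (D z)).
  by rewrite lt_def nD normc_ge0.
by rewrite /series /= big1 ?subr0 ?ltxx // => i _; rewrite a0 mul0r.
Qed.

Lemma zero_near_closed (E : set C) (D : C -> C) c : analytic_on E D -> E c ->
  (forall d : R, 0 < d -> exists2 c', normc (c' - c) < d & zero_near D c') ->
  zero_near D c.
Proof.
move=> aD Ec Dz; apply: (zero_near_accumulation aD Ec) => d d0.
have [|c' c'd [e e0 De]] := Dz (d / 2); first by rewrite divr_gt0.
move: c'd De; have [-> _ De|c'c c'd De] := eqVneq c' c; last first.
  by exists c'; split => //; [lra|apply: De; rewrite subrr normc0].
(* When c' = c, any other point of the ball around c serves as the zero. *)
have m0 : 0 < Num.min d e / 2 by rewrite divr_gt0 // lt_min d0.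
have mE : normc ((Num.min d e / 2)%:C : C) = Num.min d e / 2.
  by rewrite normc_real gtr0_norm.
have : Num.min d e / 2 < Num.min d e by lra.
rewrite lt_min => /andP[md me].
exists (c + (Num.min d e / 2)%:C); split.
- by rewrite -subr_eq0 (addrC c) addrK -normc_gt0 mE.
- by rewrite (addrC c) addrK mE.
- by apply: De; rewrite (addrC c) addrK mE.
Qed.

(** The parameters up to which the function vanishes locally form an interval,
    closed by zero_near_closed and open by definition. *)
Lemma zero_near_segment (E : set C) (D : C -> C) (c0 c1 : C) :
  analytic_on E D ->
  (forall t : R, 0 <= t <= 1 -> E (c0 + t%:C * (c1 - c0))) ->
  zero_near D c0 -> zero_near D c1.
Proof.
move=> aD Eseg z0; pose g (t : R) := c0 + t%:C * (c1 - c0).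
pose L := normc (c1 - c0) + 1.
have L0 : 0 < L by rewrite ltr_wpDl ?normc_ge0.
have gL s t : normc (g s - g t) <= L * `|s - t|.
  have -> : g s - g t = (s - t)%:C * (c1 - c0).
    by rewrite /g rmorphB /=; ring.
  by rewrite normcM normc_real mulrC ler_wpM2r // lerDl.
pose S := [set t : R | 0 <= t <= 1 /\ forall s, 0 <= s <= t -> zero_near D (g s)].
have S0 : S 0.
  split; first by rewrite lexx ler01.
  by move=> s /le_anti <-; rewrite /g mul0r addr0.
have S1 : ubound S 1 by move=> t [/andP[]].
have supS : has_sup S by split; [exists 0|exists 1].
pose T := sup S.
have T0 : 0 <= T by apply: ub_le_sup => //; exists 1.
have T1 : T <= 1 by apply: ge_sup => //; exists 0.
have below s : 0 <= s < T -> zero_near D (g s).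
  move=> /andP[s0 sT].
  have [|t [_ tS] st] := @sup_adherent _ S (T - s) _ supS.
    by rewrite subr_gt0.
  by apply: tS; rewrite s0 /=; rewrite -/T in st; lra.
have zT : zero_near D (g T).
  have [->|Tn0] := eqVneq T 0; first by rewrite /g mul0r addr0.
  have {}Tn0 : 0 < T by rewrite lt_def Tn0.
  apply: (zero_near_closed aD) => [|d d0]; first by apply: Eseg; rewrite T0.
  have dL : 0 < d / L by rewrite divr_gt0.
  pose m := Num.min T (d / L) / 2.
  have m0 : 0 < m by rewrite divr_gt0 // lt_min Tn0.
  have : m < Num.min T (d / L) by rewrite /m; rewrite /m in m0; lra.
  rewrite lt_min => /andP[mT md].
  exists (g (T - m)); last by apply: below; lra.
  apply: (le_lt_trans (gL _ _)).
  rewrite (_ : T - m - T = - m); last by ring.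
  by rewrite normrN gtr0_norm // mulrC -ltr_pdivlMr.
have [e e0 De] := zT.
have near s : `|s - T| < e / L / 2 -> zero_near D (g s).
  rewrite -(ltr_pM2l L0) mulrA mulrC [L * _]mulrC divfK ?gt_eqF // => sT.
  exists (e / 2) => [|z zs]; first by rewrite divr_gt0.
  apply: De; apply: (le_lt_trans (normc_ler_distD (g s) _ _)).
  have := gL s T; rewrite mulrC; lra.
have eL : 0 < e / L / 2 by rewrite !divr_gt0.
have [T1'|T1'] := ltP T 1; last first.
  have -> : c1 = g T by rewrite (@le_anti _ _ T 1) ?T1 // /g mul1r addrC subrK.
  exact: zT.
(* The ball at T still covers the parameters up to T'. *)
pose T' := Num.min 1 (T + e / L / 2 / 2).
suff ST' : S T'.
  have : T' <= T by apply: ub_le_sup => //; exists 1.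
  by rewrite leNgt lt_min T1' /= ltrDl divr_gt0.
have T'1 : T' <= 1 by rewrite ge_min lexx.
have T'T : T' <= T + e / L / 2 / 2 by rewrite ge_min lexx orbT.
split.
  by rewrite T'1 andbT le_min ler01 /=; lra.
move=> s /andP[s0 sT']; have [sT|Ts] := ltP s T; first by apply: below; rewrite s0.
by apply: near; rewrite ger0_norm ?subr_ge0 //; lra.
Qed.

(** From z = a + i b the path goes vertically away from the real axis by
    Y = rad + 1, then horizontally, then vertically to the point Y of the real
    ray.  Here sb is the sign of b, so that |b + sb t| >= |b| for t >= 0, and
    on the other two pieces one of the coordinates exceeds rad in modulus. *)
Lemma analytic_exterior_eq0 (rad : R) (D : C -> C) :
  0 < rad -> analytic_on (exterior rad) D ->
  (forall rho : R, rad < rho -> D rho%:C = 0) ->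
  forall z, exterior rad z -> D z = 0.
Proof.
move=> rad0 aD Dray z Ez.
have extP (w : C) : rad ^+ 2 < Re w ^+ 2 + Im w ^+ 2 -> exterior rad w.
  rewrite -normc_sq ltr_pXn2r // ?nnegrE ?normc_ge0 ?ltW // => rw.
  by rewrite /exterior /= normE ltcR.
have zray (rho : R) : rad < rho -> zero_near D rho%:C.
  move=> rho0; apply: (zero_near_accumulation aD).
    by rewrite /exterior /= normE ltcR normc_real gtr0_norm // (lt_trans rad0).
  move=> d d0; have d20 : 0 < d / 2 by rewrite divr_gt0.
  exists (rho + d / 2)%:C; split.
  - by rewrite -subr_eq0 -rmorphB /= (fmorph_eq0 (real_complex R)) (addrC rho) addrK gt_eqF.
  - by rewrite -rmorphB normc_real (addrC rho) addrK gtr0_norm //; lra.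
  - by apply: Dray; lra.
suff [e e0 De] : zero_near D z by apply: De; rewrite subrr normc0.
case: z Ez => a b Ez.
have {}Ez : rad ^+ 2 < a ^+ 2 + b ^+ 2.
  rewrite -(normc_sq (a +i* b)) ltr_pXn2r // ?nnegrE ?normc_ge0 ?ltW //.
  by move: Ez; rewrite /exterior /= -/(normc (a +i* b)) ltcR.
pose sb : R := if 0 <= b then 1 else -1.
have sb2 : sb ^+ 2 = 1 by rewrite /sb; case: ifP; rewrite ?sqrrN expr1n.
have sbb : 0 <= sb * b by rewrite /sb; case: ifP => ?; lra.
pose Y := rad + 1.
have q1 : zero_near D (Y +i* (b + sb * Y)).
  apply: (@zero_near_segment (exterior rad) D Y%:C) => // [t /andP[t0 t1]|].
    apply: extP; simpc => /=; rewrite /Y.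
    have : 0 <= (t * (b + sb * (rad + 1))) ^+ 2 by exact: sqr_ge0.
    by nra.
  by apply: zray; rewrite /Y ltrDl.
have q2 : zero_near D (a +i* (b + sb * Y)).
  apply: zero_near_segment aD _ q1 => t /andP[t0 t1]; apply: extP; simpc => /=.
  have : 0 <= (Y + t * (a + (- rad - 1))) ^+ 2 by exact: sqr_ge0.
  have -> : (b + sb * Y) ^+ 2 = b ^+ 2 + 2 * (sb * b) * Y + Y ^+ 2.
    by rewrite -[in RHS](mul1r (Y ^+ 2)) -[X in X * Y ^+ 2]sb2; ring.
  have : 0 <= (sb * b) * Y by rewrite mulr_ge0 // /Y; lra.
  have : rad ^+ 2 < Y ^+ 2 by rewrite /Y; nra.
  by have := sqr_ge0 b; lra.
apply: zero_near_segment aD _ q2 => t /andP[t0 t1]; apply: extP; simpc => /=.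
have -> : (b + sb * Y + t * (b + (- b - sb * Y))) ^+ 2 =
    b ^+ 2 + 2 * (sb * b) * (Y * (1 - t)) + (Y * (1 - t)) ^+ 2.
  by rewrite -[in RHS](mul1r ((Y * (1 - t)) ^+ 2)) -[X in X * _ ^+ 2]sb2; ring.
have Y0 : 0 <= Y by rewrite /Y; lra.
have : 0 <= (sb * b) * (Y * (1 - t)) by apply: mulr_ge0 => //; apply: mulr_ge0 => //; lra.
by have := sqr_ge0 (Y * (1 - t)); lra.
Qed.

Lemma analytic_onB (E : set C) (f g : C -> C) :
  analytic_on E f -> analytic_on E g -> analytic_on E (fun z => f z - g z).
Proof.
move=> af ag c Ec; have [a [e e0 fe]] := af c Ec; have [b [d d0 gd]] := ag c Ec.
exists (fun k => a k - b k), (Num.min e d) => [|z].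
  by rewrite lt_min e0.
rewrite normE ltcR lt_min -!ltcR -normE => /andP[/fe fz /gd gz].
move/cvgC: fz => fz; move/cvgC: gz => gz; apply/cvgC => eps eps0.
have eps20 : 0 < eps / 2 by rewrite divr_gt0.
have [N fN] := fz _ eps20; have [K gK] := gz _ eps20.
exists (maxn N K) => m; rewrite geq_max => /andP[/fN fm /gK gm].
have -> : series (fun k => (a k - b k) * (z - c) ^+ k) m =
    series (fun k => a k * (z - c) ^+ k) m - series (fun k => b k * (z - c) ^+ k) m.
  by rewrite /series /= -sumrB; apply: eq_bigr => i _; rewrite mulrBl.
rewrite opprD addrACA -opprD; apply: le_lt_trans (normcB _ _) _; lra.
Qed.

Lemma continuation_unique (rad : R) (f g : C -> C) : 0 < rad ->
  analytic_on (exterior rad) f -> analytic_on (exterior rad) g ->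
  (forall rho : R, rad < rho -> f rho%:C = g rho%:C) ->
  forall z, exterior rad z -> f z = g z.
Proof.
move=> rad0 af ag fg z Ez; apply/eqP; rewrite -subr_eq0; apply/eqP.
apply: (analytic_exterior_eq0 rad0 (analytic_onB af ag)) => // rho rr.
by rewrite fg // subrr.
Qed.

End identity.

(** * Local power series of a square root *)

Section sqrt_series.
Variable R : realType.
Local Notation C := R[i].
Variables q1 q2 : C.

(** Coefficients of the power series of sqrt (1 + q1 h + q2 h^2), paired with
    their predecessors, from the equation 2 q S' = q' S. *)
Fixpoint sqrt_coefs (k : nat) : C * C :=
  if k is k'.+1 then
    let: (u, v) := sqrt_coefs k' in
    (((1 - (2 * k')%:R) * q1 * u + (4 - (2 * k')%:R) * q2 * v) / (2 * k'.+1)%:R, u)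
  else (1, 0).

Definition sqrt_coef k := (sqrt_coefs k).1.

Lemma sqrt_coefS k : (2 * k.+1)%:R * sqrt_coef k.+1 =
  (1 - (2 * k)%:R) * q1 * sqrt_coef k + (4 - (2 * k)%:R) * q2 * (sqrt_coefs k).2.
Proof.
rewrite /sqrt_coef /=; case: (sqrt_coefs k) => u v.
by rewrite mulrC divfK // pnatr_eq0.
Qed.

Lemma sqrt_coefs2 k : (sqrt_coefs k.+1).2 = sqrt_coef k.
Proof. by rewrite /sqrt_coef /=; case: (sqrt_coefs k). Qed.

Let M := 1 + normc q1 + 2 * normc q2.

Lemma sqrt_coefs_le k : normc (sqrt_coef k) <= M ^+ k /\ normc (sqrt_coefs k).2 <= M ^+ k.
Proof.
have q10 := normc_ge0 q1; have q20 := normc_ge0 q2.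
have M1 : 1 <= M by rewrite /M; lra.
elim: k => [|k [IH1 IH2]]; first by rewrite -[sqrt_coef 0]/(1 : C) -[(sqrt_coefs 0).2]/(0 : C) normc_one normc0 expr0.
have Mk : 0 <= M ^+ k by rewrite exprn_ge0 //; lra.
split; last by rewrite sqrt_coefs2 exprS (le_trans IH1) // ler_peMl.
have k0 : 0 < (2 * k.+1)%:R :> R by rewrite ltr0n.
rewrite -(ler_pM2l k0).
have nk m : normc (m%:R : C) = m%:R.
  by rewrite -(rmorph_nat (real_complex R)) normc_real normr_nat.
rewrite -[X in X * normc _ <= _]nk -normcM sqrt_coefS (le_trans (normcD _ _)) // !normcM.
have k1 : normc (1 - (2 * k)%:R : C) <= (2 * k.+1)%:R.
  apply: (le_trans (normcB _ _)); rewrite nk normc_one.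
  by rewrite -(natrD _ 1) ler_nat; lia.
have k2 : normc (4 - (2 * k)%:R : C) <= 2 * (2 * k.+1)%:R.
  apply: (le_trans (normcB _ _)); rewrite !nk.
  by rewrite -natrD -natrM ler_nat; lia.
rewrite exprS.
have H1 : normc (1 - (2 * k)%:R : C) * normc q1 * normc (sqrt_coef k)
    <= (2 * k.+1)%:R * normc q1 * M ^+ k.
  by rewrite !ler_pM // ?mulr_ge0 ?normc_ge0.
have H2 : normc (4 - (2 * k)%:R : C) * normc q2 * normc (sqrt_coefs k).2
    <= 2 * (2 * k.+1)%:R * normc q2 * M ^+ k.
  by rewrite !ler_pM // ?mulr_ge0 ?normc_ge0.
have : 0 <= (2 * k.+1)%:R * M ^+ k by rewrite mulr_ge0 // ltW.
move: H1 H2; set m := M ^+ k; set K := (2 * k.+1)%:R => H1 H2 Km.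
apply: le_trans (lerD H1 H2) _.
by rewrite (_ : K * (M * m) = K * m + K * normc q1 * m + 2 * K * normc q2 * m) /M; [lra|ring].
Qed.

Let S N : {poly C} := \poly_(k < N) sqrt_coef k.
Let q : {poly C} := 1 + q1 *: 'X + q2 *: 'X^2.

(** The recursion is the differential equation, read coefficient by
    coefficient; truncation at N spoils only the coefficients from N - 1 on. *)
Lemma sqrt_poly_ode N k : (k.+1 < N)%N ->
  (2 * (q * (S N)^`()) - q^`() * S N)`_k = 0.
Proof.
move=> kN.
have SE j : (j <= k.+1)%N -> (S N)`_j = sqrt_coef j.
  by move=> jk; rewrite coef_poly (leq_ltn_trans jk kN).
have qE p : q * p = p + q1 *: ('X * p) + q2 *: ('X^2 * p).
  by rewrite /q !mulrDl mul1r -!scalerAl.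
have q'E p : q^`() * p = q1 *: p + (q2 *+ 2) *: ('X * p).
  rewrite /q !derivD !derivZ derivX derivXn -polyC1 derivC /= add0r expr1 mulrDl -!scalerAl mul1r.
  by rewrite mulrnAl -scalerMnr scalerMnl.
have vE : (sqrt_coefs k).2 = if k is k'.+1 then sqrt_coef k' else 0.
  by case: (k) => [|k'] //; rewrite sqrt_coefs2.
have := sqrt_coefS k; rewrite vE qE q'E [2 * (_ + _)]mulr_natl.
move: (S N) sqrt_coef SE => P s SE e.
rewrite !(coefD, coefN, coefMn, coefZ, coefXM, coefXnM, coef_deriv).
case: k {kN vE} SE e => [|[|k]] SE e; rewrite /= !SE //.
- have -> : s 1%N = q1 * s 0%N / 2.
    by apply: (@mulfI _ 2) => //; rewrite [LHS]e; field.
  by field.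
- have -> : s 2%N = (- q1 * s 1%N + 2 * q2 * s 0%N) / 4.
    by apply: (@mulfI _ 4) => //; rewrite [LHS]e; field.
  by field.
- move/eqP: e; rewrite -subr_eq0 => /eqP e; rewrite -[RHS]e.
  rewrite subn2 /= -(mulr_natr (s _) k.+3) -(mulr_natr (s _) k.+2) -(mulr_natr (s _) k.+1).
  rewrite !natrM -(natr1 k.+2) -(natr1 k.+1).
  by move: (k.+1%:R : C) (s k.+3) (s k.+2) (s k.+1) => m s3 s2 s1; ring.
- by lia.
- by rewrite subn2 /=; lia.
Qed.

(** W = S^2 - q satisfies q W' = q' W below the truncation, and W has no
    constant term; this determines its low coefficients to be zero. *)
Lemma sqrt_poly_sq N k : (k < N)%N -> (S N ^+ 2 - q)`_k = 0.
Proof.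
set W := S N ^+ 2 - q.
have ode : q * W^`() - q^`() * W = S N * (2 * (q * (S N)^`()) - q^`() * S N).
  by rewrite /W derivB expr2 derivM; ring.
elim/ltn_ind: k => -[|k] IH kN.
  rewrite /W /q expr2 !(coefB, coefD, coefZ, coefX, coefXn, coef1) coefM big_ord1 /= coef_poly kN.
  by rewrite -[sqrt_coef 0]/(1 : C); ring.
have := congr1 (fun p : {poly C} => p`_k) ode.
rewrite /= coefB !coefM big_ord_recl subn0 big1 => [|i _]; last first.
  have ik := ltn_ord i.
  by rewrite coef_deriv IH ?mul0rn ?mulr0 //= /bump /=; lia.
have -> : \sum_(i < k.+1) q^`()`_i * W`_(k - i) = 0.
  by apply: big1 => i _; rewrite IH ?mulr0 //; lia.
rewrite big1 => [|i _]; last by rewrite sqrt_poly_ode ?mulr0 //; lia.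
rewrite addr0 subr0 coef_deriv /q !(coefD, coefZ, coefX, coefXn, coef1) /=.
rewrite !mulr0 !addr0 mul1r => /eqP.
by rewrite mulrn_eq0 /= => /eqP.
Qed.

Lemma sqrt_poly_sq_le N k : (normc (S N ^+ 2)`_k <= k.+1%:R * M ^+ k).
Proof.
rewrite expr2 coefM (le_trans (normc_sum _ _)) //.
rewrite (_ : k.+1%:R * M ^+ k = \sum_(j < k.+1) M ^+ k); last first.
  by rewrite sumr_const card_ord mulr_natl.
apply: ler_sum => j _; rewrite normcM; have -> : M ^+ k = M ^+ j * M ^+ (k - j) by rewrite -exprD subnKC // leq_ord.
have M0 : 0 <= M by rewrite /M; have := normc_ge0 q1; have := normc_ge0 q2; lra.
have SM i : normc (S N)`_i <= M ^+ i.
  rewrite coef_poly; case: ifP => _; first by case: (sqrt_coefs_le i).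
  by rewrite normc0 exprn_ge0.
by rewrite ler_pM ?normc_ge0.
Qed.

Variables (h u : C).
Hypothesis uE : u ^+ 2 = 1 + q1 * h + q2 * h ^+ 2.
Hypothesis u_ge0 : 0 <= Re u.
Hypothesis hM : M * normc h <= 1 / 8.

Let Mh0 : 0 <= M * normc h.
Proof.
by rewrite mulr_ge0 ?normc_ge0 // /M; have := normc_ge0 q1; have := normc_ge0 q2; lra.
Qed.

(** The nonconstant terms are dominated by a geometric series of ratio
    M |h| <= 1/8. *)
Lemma sqrt_poly_near1 N : (0 < N)%N -> 1 / 2 <= Re ((S N).[h]).
Proof.
case: N => // N _.
have -> : (S N.+1).[h] = 1 + \sum_(1 <= k < N.+1) sqrt_coef k * h ^+ k.
  rewrite horner_poly -(big_mkord xpredT (fun k => sqrt_coef k * h ^+ k)).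
  by rewrite big_nat_recl // expr0 mulr1 big_add1.
set T := \sum_(_ <= _ < _) _.
have : normc T <= 2 * (M * normc h).
  rewrite (le_trans (normc_sum _ _)) //.
  apply: (@le_trans _ _ (\sum_(1 <= k < 1 + N) (M * normc h) ^+ k)).
    rewrite add1n; apply: ler_sum_nat => k _; rewrite normcM normcX exprMn.
    by rewrite ler_wpM2r ?exprn_ge0 ?normc_ge0 //; case: (sqrt_coefs_le k).
  rewrite -[X in 2 * X]expr1; apply: geo_tail_le.
  by rewrite Mh0 /=; apply: le_trans hM _; lra.
have := normc_ge_absRe T; rewrite ler_norml => /andP[+ _].
rewrite ReD -[Re 1]/(1 : R); have := hM; lra.
Qed.

(** S^2 - q has fewer than 2 N terms, all of degree at least N and with
    coefficients at most 2 N M^k; M |h| <= 1/8 beats the factor 2 N^2. *)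
Lemma sqrt_poly_sq_horner N : (2 < N)%N ->
  normc (u ^+ 2 - (S N).[h] ^+ 2) <= 2 * (1 / 2) ^+ N.
Proof.
move=> N2.
have -> : u ^+ 2 - (S N).[h] ^+ 2 = - (S N ^+ 2 - q).[h].
  by rewrite uE hornerD hornerN horner_exp /q !hornerE; ring.
rewrite normc_opp.
have szW : (size ((S N ^+ 2 - q)%R : {poly C}) <= N + N)%N.
  rewrite (leq_trans (size_polyD _ _)) // size_polyN geq_max; apply/andP; split.
    rewrite expr2 (leq_trans (size_polyMleq _ _)) //.
    by rewrite (leq_trans (leq_pred _)) // leq_add // size_poly.
  rewrite /q (leq_trans (size_polyD _ _)) // geq_max (leq_trans (size_polyD _ _)) ?geq_max.
    by rewrite (leq_trans (size_scale_leq _ _)) // size_polyXn; lia.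
  rewrite size_poly1 (leq_trans (size_scale_leq _ _)) ?size_polyX //; lia.
rewrite (horner_coef_wide _ szW) -(big_mkord xpredT (fun k => (S N ^+ 2 - q)`_k * h ^+ k)).
rewrite (@big_cat_nat _ _ _ N) //= ?leq_addr // big1_seq ?add0r => [|i]; last first.
  by rewrite mem_index_iota /= => /sqrt_poly_sq ->; rewrite mul0r.
rewrite (le_trans (normc_sum _ _)) //.
apply: (@le_trans _ _ (\sum_(N <= k < N + N) (2 * N)%:R * (1 / 8) ^+ N)).
  apply: ler_sum_nat => k /andP[Nk kN]; rewrite coefB.
  have -> : q`_k = 0.
    rewrite /q !(coefD, coefZ, coefX, coefXn, coef1).
    rewrite !(gtn_eqF (_ : _ < k)%N) ?mulr0 ?addr0 //; lia.
  rewrite subr0 normcM normcX.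
  apply: (@le_trans _ _ (k.+1%:R * (M * normc h) ^+ k)).
    by rewrite exprMn mulrA ler_wpM2r ?exprn_ge0 ?normc_ge0 // sqrt_poly_sq_le.
  apply: ler_pM => //; first by rewrite exprn_ge0.
    by rewrite ler_nat; lia.
  apply: (@le_trans _ _ ((1/8) ^+ k)); first by rewrite lerXn2r // nnegrE.
  by apply: ler_wiXn2l => //; lra.
rewrite sumr_const_nat addnK -mulrnAl -mulrnA.
apply: (@le_trans _ _ ((2 * 4 ^ N)%:R * (1 / 8) ^+ N)).
  rewrite ler_wpM2r ?exprn_ge0 // ler_nat -mulnA leq_mul2l /=.
  have : (N <= 2 ^ N)%N by apply/ltnW/ltn_expl.
  by rewrite (expnMn 2 2 N) => ?; exact: leq_mul.
by rewrite natrM natrX -mulrA -exprMn (_ : 4 * (1 / 8) = 1 / 2 :> R) //; field.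
Qed.

(** u - S = (u^2 - S^2) / (u + S), and u + S stays away from 0 because both
    summands lie in the right half-plane.  So the partial sums converge to the
    given root u. *)
Lemma sqrt_pseries : series (fun k => sqrt_coef k * h ^+ k) @ \oo --> (u : C^o).
Proof.
apply/cvgC => e e0.
have [K Ke] : exists K : nat, 4 / e < K%:R.
  exists (Num.truncn (4 / e)).+1; exact: truncnS_gt.
exists (K + 3)%N => N KN.
have -> : series (fun k => sqrt_coef k * h ^+ k) N = (S N).[h].
  by rewrite horner_poly /series /= big_mkord.
have N2 : (2 < N)%N by lia.
have := sqrt_poly_sq_horner N2; rewrite subr_sqr normcM.
have uS : 1 / 2 <= normc (u + (S N).[h]).
  have := normc_ge_absRe (u + (S N).[h]); rewrite ler_norml => /andP[_]; apply: le_trans.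
  rewrite ReD.
  have := @sqrt_poly_near1 N; rewrite (ltn_trans _ N2) // => /(_ isT); have := u_ge0; lra.
have N2e : 4 * (1 / 2) ^+ N < e.
  rewrite expr_div_n expr1n mulrA mulr1 ltr_pdivrMr ?exprn_gt0 // mulrC -ltr_pdivrMr //.
  apply: (lt_trans Ke); rewrite -natrX ltr_nat (leq_ltn_trans _ (ltn_expl N (ltnSn 1))) //; lia.
have := normc_ge0 (u - (S N).[h]); nra.
Qed.

End sqrt_series.

(** * The continuation of the distance along a ray *)

Section branch.
Variable R : realType.
Local Notation C := R[i].

Lemma sqrtc_Re_gt0 (z : C) : (Im z = 0 -> 0 < Re z) -> 0 < Re (sqrtc z).
Proof.
case: z => x y /= zP; rewrite sqrtr_gt0 divr_gt0 //.
have sq : Num.sqrt (x ^+ 2 + y ^+ 2) ^+ 2 = x ^+ 2 + y ^+ 2.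
  by rewrite sqr_sqrtr // addr_ge0 ?sqr_ge0.
have := sqrtr_ge0 (x ^+ 2 + y ^+ 2); move: sq; set s := Num.sqrt _ => sq s0.
have [y0|y0] := eqVneq y 0; first by have := zP y0; lra.
have : 0 < y ^+ 2 by rewrite exprn_even_gt0.
by nra.
Qed.

Variables (rad a b : R).
Hypotheses (rad0 : 0 < rad) (ab : a ^+ 2 <= b) (brad : b <= rad ^+ 2).

Definition radicand (z : C) : C := 1 - 2 * a%:C / z + b%:C / z ^+ 2.
Definition rbranch (z : C) : C := z * sqrtc (radicand z).

Lemma exteriorP (z : C) : exterior rad z <-> rad < normc z.
Proof. by rewrite /exterior /= normE ltcR. Qed.

Lemma exterior_neq0 (z : C) : exterior rad z -> z != 0.
Proof. by move/exteriorP => ?; rewrite -normc_gt0 (lt_trans rad0). Qed.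

Lemma radicandE z : z != 0 -> z ^+ 2 * radicand z = z ^+ 2 - 2 * a%:C * z + b%:C.
Proof. by move=> z0; rewrite /radicand; field. Qed.

Lemma rbranch_sq z : z != 0 -> rbranch z ^+ 2 = z ^+ 2 - 2 * a%:C * z + b%:C.
Proof. by move=> z0; rewrite /rbranch exprMn sqr_sqrtc radicandE. Qed.

(** If z^2 q = z^2 - 2 a z + b with q = t <= 0, then either z is real and
    completing the square gives z = a, or the two conjugate roots have
    |z|^2 = b / (1 - t); both contradict |z| > rad. *)
Lemma radicand_slit z : exterior rad z -> Im (radicand z) = 0 -> 0 < Re (radicand z).
Proof.
move=> Ez qi; rewrite ltNge; apply/negP => qr.
have z0 := exterior_neq0 Ez; have := radicandE z0.
have -> : radicand z = (Re (radicand z))%:C by move: qi; case: (radicand z) => x y /= ->.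
move: (Re _) qr => t t0.
have : rad ^+ 2 < normc z ^+ 2 by rewrite ltrXn2r ?nnegrE ?normc_ge0 ?ltW //; exact/exteriorP.
rewrite normc_sq.
case: z {Ez qi z0} => u v /= uv /eqP; rewrite !expr2.
have -> : (2 : C) = (2 +i* 0) by rewrite -[LHS](rmorph_nat (real_complex R)).
simpc => /=; rewrite eq_complex /= => /andP[/eqP e1 /eqP e2].
have s1 : 1 <= 1 - t by lra.
have {}e1 : (1 - t) * (u ^+ 2 - v ^+ 2) - 2 * a * u + b = 0 by rewrite !expr2; lra.
have {}e2 : v * ((1 - t) * u - a) = 0 by lra.
have [v0|v0] := eqVneq v 0.
  have : (u - a) ^+ 2 + (- t) * u ^+ 2 + (b - a ^+ 2) = 0 by rewrite -[RHS]e1 v0; ring.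
  have : 0 <= (- t) * u ^+ 2 by rewrite mulr_ge0 ?sqr_ge0 //; lra.
  have := sqr_ge0 (u - a) => ua tu s.
  have /eqP : (u - a) ^+ 2 = 0 by apply: le_anti; rewrite ua andbT; have := ab; lra.
  rewrite sqrf_eq0 subr_eq0 => /eqP ua'; move: uv; rewrite v0 ua' expr0n /=; have := ab; have := brad; lra.
have {v0}au : a = (1 - t) * u.
  by move/eqP: e2; rewrite mulf_eq0 (negPf v0) /= subr_eq0 => /eqP.
have : (1 - t) * (u ^+ 2 + v ^+ 2) = b.
  by apply/eqP; rewrite -subr_eq0 -[X in _ == X]oppr0 -[X in _ == - X]e1 au; apply/eqP; ring.
have := brad; have := sqr_ge0 u; have := sqr_ge0 v; have := sqr_ge0 rad; nra.
Qed.

(** The square of the branch factors as z - w times z minus the conjugate of w,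
    where |w| = sqrt b <= rad. *)
Lemma rbranch_norm_ge z : exterior rad z -> normc z - rad <= normc (rbranch z).
Proof.
move=> Ez; have z0 := exterior_neq0 Ez.
have zr : 0 < normc z - rad by rewrite subr_gt0; exact/exteriorP.
have b0 : 0 <= b - a ^+ 2 by rewrite subr_ge0.
pose w : C := a +i* Num.sqrt (b - a ^+ 2).
have nw : normc w <= rad.
  rewrite -(@ler_pXn2r _ 2) ?nnegrE ?normc_ge0 ?(ltW rad0) // normc_sq /= sqr_sqrtr //.
  by rewrite addrC subrK.
have nw' : normc (w^*) <= rad.
  by rewrite (_ : normc (w^*) = normc w) //; apply: complexI; rewrite -!normE normcJ.
have lower v : normc v <= rad -> normc z - rad <= normc (z - v).
  by have := normcD (z - v) v; rewrite subrK; lra.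
rewrite -(@ler_pXn2r _ 2) ?nnegrE ?normc_ge0 ?(ltW zr) // -normcX rbranch_sq //.
have -> : z ^+ 2 - 2 * a%:C * z + b%:C = (z - w) * (z - w^*).
  have : w * w^* = b%:C.
    by rewrite -sqr_normc normE -rmorphXn normc_sq /= sqr_sqrtr // addrC subrK.
  have : w + w^* = 2 * a%:C by rewrite addcJ.
  by move=> e1 e2; rewrite -e1 -e2; ring.
by rewrite normcM expr2 ler_pM ?(ltW zr) // lower.
Qed.

Lemma rbranch_neq0 z : exterior rad z -> rbranch z != 0.
Proof.
move=> Ez; rewrite -normc_gt0 (lt_le_trans _ (rbranch_norm_ge Ez)) // subr_gt0.
exact/exteriorP.
Qed.

Lemma rbranch_real (rho : R) : rad < rho ->
  rbranch rho%:C = (Num.sqrt (rho ^+ 2 - 2 * a * rho + b))%:C.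
Proof.
move=> rr; have rho0 : 0 < rho by rewrite (lt_trans rad0).
have qE : radicand rho%:C = (1 - 2 * a / rho + b / rho ^+ 2)%:C.
  by rewrite /radicand !(rmorphD, rmorphN, rmorphM, fmorphV, rmorphXn, rmorph_nat, rmorph1) /=.
have q0 : 0 <= 1 - 2 * a / rho + b / rho ^+ 2.
  have -> : 1 - 2 * a / rho + b / rho ^+ 2 = ((rho - a) ^+ 2 + (b - a ^+ 2)) / rho ^+ 2.
    by field; rewrite gt_eqF.
  by rewrite divr_ge0 ?exprn_ge0 ?(ltW rho0) // addr_ge0 ?sqr_ge0 // subr_ge0.
rewrite /rbranch qE sqrtc_sqrtr ?ler0c // -rmorphM /=; congr (_ %:C).
rewrite -{1}(ger0_norm (ltW rho0)) -sqrtr_sqr -sqrtrM ?sqr_ge0 //; congr Num.sqrt.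
by field; rewrite gt_eqF.
Qed.

(** Around c, the quotient u = rbranch z / rbranch c is a square root of a
    quadratic polynomial in h = z - c with constant term 1, so sqrt_pseries
    applies once Re u >= 0.  Otherwise u would be close to -1 for small h, and
    then sqrtc (radicand z) would be close to - sqrtc (radicand c), whereas both
    have positive real part. *)
Lemma rbranch_analytic : analytic_on (exterior rad) rbranch.
Proof.
move=> c Ec; have c0 := exterior_neq0 Ec; have gc0 := rbranch_neq0 Ec.
pose B := sqrtc (radicand c).
have B0 : 0 < Re B by exact/sqrtc_Re_gt0/radicand_slit.
have nB0 : 0 < normc B.
  by apply: lt_le_trans B0 (le_trans (ler_norm _) (normc_ge_absRe _)).
pose p := rbranch c ^+ 2.
have p0 : p != 0 by rewrite expf_neq0.
pose q1 := (2 * c - 2 * a%:C) / p; pose q2 := p^-1.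
pose M := 1 + normc q1 + 2 * normc q2.
have q10 := normc_ge0 q1; have q20 := normc_ge0 q2.
have M1 : 1 <= M by rewrite /M; lra.
have M0 : 0 < M by lra.
have nc0 : 0 < normc c by rewrite normc_gt0.
pose K := (M + 4 / normc c) * normc B.
have K0 : 0 < K by rewrite mulr_gt0 // addr_gt0 // divr_gt0.
pose e := Num.min (Num.min (1 / 8 / M) (normc c / 2)) (Num.min (normc c - rad) (Re B / K)).
exists (fun k => rbranch c * sqrt_coef q1 q2 k), e => [|z].
  by rewrite /e !lt_min !divr_gt0 //= andbT subr_gt0; exact/exteriorP.
rewrite normE ltcR /e !lt_min -andbA => /and4P[hM hc hrad hB].
set h := z - c in hM hc hrad hB *.
have zE : z = c + h by rewrite /h addrC subrK.
have zh : z - h = c by rewrite zE addrK.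
have Ez : exterior rad z.
  by apply/exteriorP; have := normcB z h; rewrite zh; lra.
have z0 := exterior_neq0 Ez.
pose u := rbranch z / rbranch c.
have uE : u ^+ 2 = 1 + q1 * h + q2 * h ^+ 2.
  rewrite /u expr_div_n -/p rbranch_sq // {1 2}zE /q1 /q2.
  have : p = c ^+ 2 - 2 * a%:C * c + b%:C by rewrite /p rbranch_sq.
  move=> pE; apply: (mulIf p0); rewrite divfK // !mulrDl mul1r.
  by rewrite {1}pE; field.
have {}hM : M * normc h <= 1 / 8 by rewrite mulrC -ler_pdivlMr // ltW.
have u0 : 0 <= Re u.
  rewrite leNgt; apply/negP => uneg.
  have u1 : normc (u + 1) <= M * normc h.
    have : normc (u - 1) * normc (u + 1) <= M * normc h.
      rewrite -normcM -subr_sqr expr1n uE (_ : _ - 1 = q1 * h + q2 * h * h); last by ring.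
      rewrite (le_trans (normcD _ _)) // (normcM q1) (normcM (q2 * h)) (normcM q2) /M.
      have h1 : normc h <= 1 by have := normc_ge0 h; nra.
      have h0 := normc_ge0 h.
      have : 0 <= normc q2 * normc h * (1 - normc h) by rewrite !mulr_ge0 // subr_ge0.
      have : 0 <= normc q2 * normc h by rewrite mulr_ge0.
      lra.
    have : 1 <= normc (u - 1).
      have := normc_ge_absRe (u - 1); rewrite ReD ReN -[Re 1]/(1 : R) ler_norml => /andP[+ _].
      lra.
    have := normc_ge0 (u + 1); nra.
  have A0 : 0 < Re (sqrtc (radicand z)) by exact/sqrtc_Re_gt0/radicand_slit.
  pose A := sqrtc (radicand z).
  have AE : A = - B + ((u + 1) * B - A * h / c).
    rewrite /u /rbranch -/A -/B {1}zE; field; rewrite c0 /=.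
    by rewrite -normc_gt0.
  have nu : normc u <= 2.
    have := normcB (u + 1) 1; rewrite addrK normc_one; lra.
  have nA : normc A <= 4 * normc B.
    have : normc A * normc z = normc u * normc B * normc c.
      rewrite -!normcM; congr normc; rewrite /u /rbranch -/A -/B; field.
      by rewrite c0 -normc_gt0 nB0.
    have : normc c / 2 <= normc z.
      by have := normcB z h; rewrite zh; lra.
    move=> cz AE'; rewrite -(ler_pM2r nc0).
    have := ler_wpM2l (normc_ge0 A) cz; rewrite AE'.
    have : normc u * (normc B * normc c) <= 2 * (normc B * normc c).
      by rewrite ler_wpM2r // mulr_ge0 // ltW.
    lra.
  have : Re A <= - Re B + (M * normc h * normc B + 4 * normc B * normc h / normc c).
    rewrite {1}AE ReD ReN lerD2l.
    apply: le_trans (ler_norm _) (le_trans (normc_ge_absRe _) (le_trans (normcB _ _) _)).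
    rewrite !normcM normcV lerD //; first by rewrite ler_wpM2r // ltW.
    by rewrite ler_wpM2r ?invr_ge0 ?normc_ge0 // ler_wpM2r // normc_ge0.
  move: hB; rewrite ltr_pdivlMr //.
  have -> : normc h * K = M * normc h * normc B + 4 * normc B * normc h / normc c.
    by rewrite /K; ring.
  rewrite -/A in A0; lra.
have /cvgC cv := sqrt_pseries uE u0 hM.
apply/cvgC => e' e'0.
have gn0 : 0 < normc (rbranch c) by rewrite normc_gt0.
have [|N sN] := cv (e' / normc (rbranch c)); first by rewrite divr_gt0.
exists N => k /sN; rewrite ltr_pdivlMr // mulrC -normcM mulrBr /u mulrC divfK //.
rewrite (_ : rbranch c * series _ k = series (fun k => rbranch c * sqrt_coef q1 q2 k * h ^+ k) k) //.
by rewrite /series /= mulr_sumr; apply: eq_bigr => i _; rewrite mulrA.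
Qed.

End branch.

(** * Bounded measurable functions, real and complex *)

Section bounded_measurable.
Context d (T : measurableType d) (R : realType).
Variable D : set T.
Implicit Types f g : T -> R.

(** Unlike integrability, this is preserved by products, and it implies
    integrability for every finite measure. *)
Definition bmeas f := measurable_fun D f /\ exists M : R, forall x, D x -> `|f x| <= M.

Lemma bmeas_cst c : bmeas (fun=> c).
Proof. by split; [exact: measurable_cst|exists `|c|]. Qed.

Lemma bmeasD f g : bmeas f -> bmeas g -> bmeas (fun x => f x + g x).
Proof.
move=> [mf [M fM]] [mg [N gN]]; split; first exact: measurable_funD.
by exists (M + N) => x Dx; rewrite (le_trans (ler_normD _ _)) // lerD ?fM ?gN.
Qed.

Lemma bmeasM f g : bmeas f -> bmeas g -> bmeas (fun x => f x * g x).
Proof.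
move=> [mf [M fM]] [mg [N gN]]; split; first exact: measurable_funM.
by exists (M * N) => x Dx; rewrite normrM ler_pM ?fM ?gN.
Qed.

Lemma bmeasX f k : bmeas f -> bmeas (fun x => f x ^+ k).
Proof.
move=> bf; elim: k => [|k IH]; first exact: bmeas_cst.
by under eq_fun do rewrite exprS; exact: bmeasM.
Qed.

Lemma bmeasN f : bmeas f -> bmeas (fun x => - f x).
Proof.
move=> fD; have -> : (fun x => - f x) = (fun x => -1 * f x).
  by apply/funext => x; rewrite mulN1r.
exact: bmeasM (bmeas_cst _) fD.
Qed.

Lemma bmeas_sum (I : Type) (r : seq I) (F : I -> T -> R) :
  (forall i, bmeas (F i)) -> bmeas (fun x => \sum_(i <- r) F i x).
Proof.
move=> bF; elim: r => [|i r IH].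
  by under eq_fun do rewrite big_nil; exact: bmeas_cst.
by under eq_fun do rewrite big_cons; exact: bmeasD.
Qed.

Lemma bmeas_integrable (mu : {finite_measure set T -> \bar R}) f :
  measurable D -> bmeas f -> mu.-integrable D (EFin \o f).
Proof.
move=> mD [mf [M fM]]; apply: measurable_bounded_integrable => //.
  by rewrite -ge0_fin_numE // fin_num_measure.
exists M; split; first exact: num_real.
by move=> N MN x Dx; exact: le_trans (fM _ Dx) (ltW MN).
Qed.

Lemma measurable_fun_inv f : measurable_fun D f -> (forall x, D x -> 0 <= f x) ->
  measurable_fun D (fun x => (f x)^-1).
Proof.
move=> mf f0; apply: (eq_measurable_fun (fun x => f x `^ (-1))).
  by move=> x; rewrite inE => Dx; rewrite powR_inv1 // f0.
exact: (measurableT_comp (@measurable_powR R (-1)) mf).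
Qed.

Lemma measurable_fun_sqrt f : measurable_fun D f ->
  measurable_fun D (fun x => Num.sqrt (f x)).
Proof.
move=> mf; apply: (measurableT_comp _ mf).
apply: continuous_measurable_fun; exact: sqrt_continuous.
Qed.

Local Notation C := R[i].
Implicit Types u v : T -> C.

Definition cmeas u := measurable_fun D (fun x => Re (u x)) /\
  measurable_fun D (fun x => Im (u x)).

Definition cbmeas u := bmeas (fun x => Re (u x)) /\ bmeas (fun x => Im (u x)).

Lemma cbmeas_cst c : cbmeas (fun=> c).
Proof. by split; exact: bmeas_cst. Qed.

Lemma cbmeasD u v : cbmeas u -> cbmeas v -> cbmeas (fun x => u x + v x).
Proof.
move=> [ur ui] [vr vi]; split.
- by under eq_fun do rewrite ReD; exact: bmeasD.
- by under eq_fun do rewrite ImD; exact: bmeasD.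
Qed.

Lemma cbmeasM u v : cbmeas u -> cbmeas v -> cbmeas (fun x => u x * v x).
Proof.
move=> [ur ui] [vr vi]; split.
- under eq_fun do rewrite ReM; apply: bmeasD; first exact: bmeasM.
  by apply: bmeasN; exact: bmeasM.
- by under eq_fun do rewrite ImM; apply: bmeasD; exact: bmeasM.
Qed.

Lemma cbmeasX u k : cbmeas u -> cbmeas (fun x => u x ^+ k).
Proof.
move=> bu; elim: k => [|k IH]; first exact: cbmeas_cst.
by under eq_fun do rewrite exprS; exact: cbmeasM.
Qed.

Lemma cbmeasV u (e : R) : cmeas u -> 0 < e -> (forall x, D x -> e <= normc (u x)) ->
  cbmeas (fun x => (u x)^-1).
Proof.
move=> [mr mi] e0 ue.
have mn : measurable_fun D (fun x => (Re (u x) ^+ 2 + Im (u x) ^+ 2)^-1).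
  apply: measurable_fun_inv => [|x _]; last by rewrite addr_ge0 ?sqr_ge0.
  by apply: measurable_funD; exact: measurable_funX.
have nV x : D x -> normc (u x)^-1 <= e^-1.
  by move=> Dx; rewrite normcV lef_pV2 ?posrE ?ue // (lt_le_trans e0) ?ue.
have ImN (z : C) : `|Im z| <= normc z.
  rewrite -(@ler_pXn2r _ 2) ?nnegrE ?normr_ge0 ?normc_ge0 //.
  by rewrite normc_sq real_normK ?num_real // lerDr sqr_ge0.
split; split.
- by under eq_fun do rewrite ReV; exact: measurable_funM.
- by exists e^-1 => x Dx; exact: le_trans (normc_ge_absRe _) (nV _ Dx).
- by under eq_fun do rewrite ImV; apply: measurable_funN; exact: measurable_funM.
- by exists e^-1 => x Dx; exact: le_trans (ImN _) (nV _ Dx).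
Qed.

Variable mu : {finite_measure set T -> \bar R}.
Hypothesis mD : measurable D.

Lemma CintegralZ c u : cbmeas u -> Cintegral mu D (fun x => c * u x) = c * Cintegral mu D u.
Proof.
move=> [ur ui]; rewrite /Cintegral.
have iZ f k : bmeas f -> mu.-integrable D (EFin \o (fun x => k * f x)).
  by move=> bf; apply: bmeas_integrable => //; exact: bmeasM (bmeas_cst _) bf.
have Z f k : bmeas f -> Rintegral mu D (fun x => k * f x) = k * Rintegral mu D f.
  by move=> bf; rewrite RintegralZl //; exact: bmeas_integrable.
under eq_Rintegral do rewrite ReM.
under [in X in _ +i* X]eq_Rintegral do rewrite ImM.
rewrite RintegralB ?RintegralD ?iZ // !Z //.
by case: c => a b.
Qed.

Lemma CintegralD u v : cbmeas u -> cbmeas v ->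
  Cintegral mu D (fun x => u x + v x) = Cintegral mu D u + Cintegral mu D v.
Proof.
move=> [ur ui] [vr vi]; rewrite /Cintegral.
under eq_Rintegral do rewrite ReD.
under [in X in _ +i* X]eq_Rintegral do rewrite ImD.
by rewrite !RintegralD //; exact: bmeas_integrable.
Qed.

End bounded_measurable.

(** * The Borel sigma-algebra of R^n *)

Section borel.
Variables (R : realType) (n : nat).
Local Notation T := (borelRn R n).

Lemma open_borel (U : set 'rV[R]_n) : open U -> measurable (U : set T).
Proof. by move=> oU; apply: sub_sigma_algebra. Qed.

Lemma continuous_borel (f : 'rV[R]_n -> R) : continuous f ->
  measurable_fun setT (f : T -> R).
Proof.
move=> /continuousP cf; apply: (measurability _ (RGenOpens.measurableE R)).
move=> _ [_ [a [b ->] <-]]; rewrite setTI; apply: open_borel.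
exact/cf/interval_open.
Qed.

Lemma coord_borel i : measurable_fun setT ((fun x : 'rV[R]_n => x 0 i) : T -> R).
Proof. by apply: continuous_borel; exact: coord_continuous. Qed.

Lemma enorm_ge0 (x : 'rV[R]_n) : 0 <= enorm x.
Proof. exact: sqrtr_ge0. Qed.

Lemma enorm_sq (x : 'rV[R]_n) : enorm x ^+ 2 = \sum_i x 0 i ^+ 2.
Proof. by rewrite sqr_sqrtr // sumr_ge0 // => i _; exact: sqr_ge0. Qed.

Lemma coord_le_enorm (x : 'rV[R]_n) i : `|x 0 i| <= enorm x.
Proof.
rewrite -(@ler_pXn2r _ 2) ?nnegrE ?enorm_ge0 // enorm_sq real_normK ?num_real //.
by rewrite (bigD1 i) //= lerDl sumr_ge0 // => j _; exact: sqr_ge0.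
Qed.

Lemma enorm_borel (y : 'rV[R]_n) :
  measurable_fun setT ((fun x : 'rV[R]_n => enorm (y - x)) : T -> R).
Proof.
apply: measurable_fun_sqrt; apply: measurable_sum => i.
apply: measurable_funX; under eq_fun do rewrite !mxE.
by apply: measurable_funB; [exact: measurable_cst|exact: coord_borel].
Qed.

Lemma cball_borel rad : measurable (cball rad : set T).
Proof.
have : measurable_fun setT ((fun x : 'rV[R]_n => enorm x) : T -> R).
  apply: measurable_fun_sqrt; apply: measurable_sum => i.
  by apply: measurable_funX; exact: coord_borel.
move=> /(_ measurableT _ (measurable_itv `]-oo, rad])); rewrite setTI.
congr measurable; apply/seteqP; split => x /=; by rewrite in_itv.
Qed.

(** Properties of the real and imaginary parts of a polynomial follow from
    closure under the operations that build real polynomials. *)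
Lemma evalR_ind (Z : ('rV[R]_n -> R) -> Prop) :
  Z (fun=> 1) ->
  (forall f g, Z f -> Z g -> Z (fun x => f x + g x)) ->
  (forall c f, Z f -> Z (fun x => c * f x)) ->
  (forall i f, Z f -> Z (fun x => x 0 i * f x)) ->
  forall P, Z (fun x => Re (evalR P x)) /\ Z (fun x => Im (evalR P x)).
Proof.
move=> Z1 ZD ZZ ZX P.
have ZXn i k f : Z f -> Z (fun x => x 0 i ^+ k * f x).
  move=> Zf; elim: k => [|k IH]; first by under eq_fun do rewrite expr0 mul1r.
  by under eq_fun do rewrite exprS -mulrA; exact: ZX.
have Zprod (r : seq 'I_n) (m : 'I_n -> nat) : Z (fun x => \prod_(i <- r) x 0 i ^+ m i).
  elim: r => [|i r IH]; first by under eq_fun do rewrite big_nil.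
  by under eq_fun do rewrite big_cons; exact: ZXn.
have Z0 : Z (fun=> 0) by have := ZZ 0 _ Z1; under eq_fun do rewrite mul0r.
have evalE x : evalR P x = \sum_(m <- mpoly.msupp P)
    mpoly.mcoeff m P * (\prod_(i < n) x 0 i ^+ mpoly.fun_of_multinom m i)%:C.
  rewrite /evalR mpoly.mevalE; apply: eq_bigr => m _; congr (_ * _).
  by rewrite rmorph_prod; apply: eq_bigr => i _; rewrite rmorphXn.
have ReZ (z : R[i]) (r : R) : Re (z * r%:C) = Re z * r.
  by rewrite ReM mulr0 subr0.
have ImZ (z : R[i]) (r : R) : Im (z * r%:C) = Im z * r.
  by rewrite ImM mulr0 add0r.
split.
- under eq_fun do rewrite evalE.
  elim: (mpoly.msupp P) => [|m s IH]; first by under eq_fun do rewrite big_nil.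
  by under eq_fun do rewrite big_cons ReD ReZ; apply: ZD => //; exact: ZZ.
- under eq_fun do rewrite evalE.
  elim: (mpoly.msupp P) => [|m s IH]; first by under eq_fun do rewrite big_nil.
  under eq_fun do rewrite big_cons ImD ImZ.
  by apply: ZD => //; exact: ZZ.
Qed.

End borel.

(** * The kernel of the Markov transform *)

Section kernel.
Variables (R : realType) (n : nat) (rad : R).
Hypothesis rad0 : 0 < rad.
Implicit Types (x theta : 'rV[R]_n) (zeta : R[i]).
Local Notation T := (borelRn R n).

Definition dotp theta x : R := \sum_i theta 0 i * x 0 i.

Lemma sphere_sum theta : sphere theta -> \sum_i theta 0 i ^+ 2 = 1.
Proof. by rewrite /sphere /= => th; rewrite -enorm_sq th expr1n. Qed.

(** |x - <theta, x> theta|^2 is nonnegative. *)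
Lemma dotp_sq_le theta x : sphere theta -> dotp theta x ^+ 2 <= enorm x ^+ 2.
Proof.
move=> /sphere_sum th; set a := dotp theta x.
have expand (c : R) : \sum_i (x 0 i - c * theta 0 i) ^+ 2 =
    \sum_i x 0 i ^+ 2 - 2 * c * dotp theta x + c ^+ 2 * \sum_i theta 0 i ^+ 2.
  rewrite /dotp !mulr_sumr -sumrB -big_split /=; apply: eq_bigr => i _; ring.
have : 0 <= \sum_i (x 0 i - a * theta 0 i) ^+ 2 by rewrite sumr_ge0 // => i _; exact: sqr_ge0.
by rewrite expand th enorm_sq -/a; lra.
Qed.

Lemma enorm_ray theta x (rho : R) : sphere theta ->
  enorm (rho *: theta - x) = Num.sqrt (rho ^+ 2 - 2 * dotp theta x * rho + enorm x ^+ 2).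
Proof.
move=> /sphere_sum th; rewrite enorm_sq /enorm /dotp; congr Num.sqrt.
have -> : rho ^+ 2 = \sum_i rho ^+ 2 * theta 0 i ^+ 2 by rewrite -mulr_sumr th mulr1.
rewrite !mulr_sumr !mulr_suml -sumrB -big_split /=.
by apply: eq_bigr => i _; rewrite !mxE; ring.
Qed.

Lemma cball_sq x : cball rad x -> enorm x ^+ 2 <= rad ^+ 2.
Proof. by move=> xr; rewrite lerXn2r ?nnegrE ?enorm_ge0 // ltW. Qed.

(** The continuation selected by xget is explicit: one exists, and any two
    agree. *)
Lemma rcontE theta x zeta : sphere theta -> cball rad x -> exterior rad zeta ->
  rcont rad zeta theta x = rbranch (dotp theta x) (enorm x ^+ 2) zeta.
Proof.
move=> th xr Ez; set g := rbranch _ _.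
have ab := dotp_sq_le x th; have br := cball_sq xr.
have gc : is_continuation rad theta x g.
  split; first exact: rbranch_analytic.
  by move=> rho rr; rewrite /g (rbranch_real rad0 ab rr) enorm_ray.
rewrite /rcont.
have [fa fr] := xgetPex (fun=> 0) (ex_intro _ g gc).
apply: (continuation_unique rad0 fa gc.1) => // rho rr.
by rewrite fr // gc.2.
Qed.

Lemma rcont_real theta x (rho : R) : sphere theta -> cball rad x -> rad < rho ->
  rcont rad rho%:C theta x = (enorm (rho *: theta - x))%:C.
Proof.
move=> th xr rr; have rho0 : 0 < rho by rewrite (lt_trans rad0).
rewrite rcontE //; last by apply/exteriorP; rewrite normc_real gtr0_norm.
by rewrite (rbranch_real rad0 (dotp_sq_le x th) rr) enorm_ray.
Qed.

Local Notation D := (cball rad : set T).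

Lemma bmeas_coord i : bmeas D ((fun x : 'rV[R]_n => x 0 i) : T -> R).
Proof.
split; first by apply: measurable_funTS; exact: coord_borel.
by exists rad => x xr; exact: le_trans (coord_le_enorm _ _) xr.
Qed.

Lemma cbmeas_real (f : T -> R) : bmeas D f -> cbmeas D (fun x => (f x)%:C).
Proof. by move=> bf; split => //; exact: bmeas_cst. Qed.

Lemma cbmeas_evalR P : cbmeas D (fun x => evalR P x).
Proof.
apply: (@evalR_ind R n (fun f => bmeas D (f : T -> R))).
- exact: bmeas_cst.
- by move=> f g bf bg; exact: (bmeasD bf bg).
- by move=> c f bf; exact: (bmeasM (bmeas_cst _ c) bf).
- by move=> i f bf; exact: (bmeasM (bmeas_coord i) bf).
Qed.

Lemma cmeas_sqrtc (q : T -> R[i]) : cmeas D q -> cmeas D (fun x => sqrtc (q x)).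
Proof.
move=> [qr qi].
have mn : measurable_fun D (fun x => Num.sqrt (Re (q x) ^+ 2 + Im (q x) ^+ 2)).
  by apply: measurable_fun_sqrt; apply: measurable_funD; exact: measurable_funX.
(* The sign of the imaginary part is a Borel function of the argument. *)
have sqrtcE z : sqrtc z = Num.sqrt ((Num.sqrt (Re z ^+ 2 + Im z ^+ 2) + Re z) / 2) +i*
   ((if 0 <= Im z then 1 else -1) * Num.sqrt ((Num.sqrt (Re z ^+ 2 + Im z ^+ 2) - Re z) / 2)).
  case: z => a b /=; congr (_ +i* (_ * _)).
  have [->|b0] := eqVneq b 0; first by rewrite lexx.
  have [b0'|b0'] := leP 0 b; last by rewrite ltr0_sg.
  by rewrite gtr0_sg // lt_def b0.
split.
- under eq_fun do rewrite sqrtcE /=.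
  apply: measurable_fun_sqrt; apply: measurable_funM; last exact: measurable_cst.
  exact: measurable_funD.
- under eq_fun do rewrite sqrtcE /=.
  have ms : measurable_fun setT (fun y : R => if 0 <= y then 1 else -1 : R).
    apply: measurable_fun_ifT => //.
    by apply: measurable_fun_ler; [exact: measurable_cst|exact: measurable_id].
  apply: measurable_funM; first exact: (measurableT_comp ms qi).
  apply: measurable_fun_sqrt; apply: measurable_funM; last exact: measurable_cst.
  exact: measurable_funB.
Qed.

Lemma cbmeas_rcontV theta zeta : sphere theta -> exterior rad zeta ->
  cbmeas D (fun x => (rcont rad zeta theta x)^-1).
Proof.
move=> th Ez.
have zr : 0 < normc zeta - rad by rewrite subr_gt0; exact/exteriorP.
have bd : bmeas D (fun x => dotp theta x).
  by apply: bmeas_sum => i; exact: bmeasM (bmeas_cst _ _) (bmeas_coord i).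
have be : bmeas D (fun x : 'rV[R]_n => enorm x ^+ 2).
  under eq_fun do rewrite enorm_sq.
  by apply: bmeas_sum => i; under eq_fun do rewrite expr2; exact: bmeasM (bmeas_coord i) (bmeas_coord i).
have bq : cbmeas D (fun x => radicand (dotp theta x) (enorm x ^+ 2) zeta).
  under eq_fun => x.
    rewrite (_ : radicand _ _ _ = 1 + ((- 2 / zeta) * (dotp theta x)%:C + (zeta ^+ 2)^-1 * (enorm x ^+ 2)%:C)); last first.
      by rewrite /radicand; ring.
    over.
  apply: cbmeasD; first exact: cbmeas_cst.
  by apply: cbmeasD; apply: cbmeasM; [exact: cbmeas_cst|exact: cbmeas_real|exact: cbmeas_cst|exact: cbmeas_real].
have [mr mi] : cmeas D (fun x => sqrtc (radicand (dotp theta x) (enorm x ^+ 2) zeta)).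
  by apply: cmeas_sqrtc; case: bq => -[? _] [? _].
apply: (@cbmeasV _ _ _ _ _ (normc zeta - rad)) => //; last first.
  move=> x xr; rewrite rcontE //; apply: rbranch_norm_ge => //.
    exact: dotp_sq_le.
  exact: cball_sq.
have E x : x \in D -> zeta * sqrtc (radicand (dotp theta x) (enorm x ^+ 2) zeta) =
    rcont rad zeta theta x.
  by rewrite inE => xr; rewrite rcontE.
split.
- apply: (@eq_measurable_fun _ _ T R D (fun x : T => Re (zeta * sqrtc (radicand (dotp theta x) (enorm x ^+ 2) zeta)))).
    by move=> x xD; rewrite E.
  under eq_fun do rewrite ReM.
  by apply: measurable_funB; apply: measurable_funM => //; exact: measurable_cst.
- apply: (@eq_measurable_fun _ _ T R D (fun x : T => Im (zeta * sqrtc (radicand (dotp theta x) (enorm x ^+ 2) zeta)))).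
    by move=> x xD; rewrite E.
  under eq_fun do rewrite ImM.
  by apply: measurable_funD; apply: measurable_funM => //; exact: measurable_cst.
Qed.

Definition markov_kernel zeta theta x : R[i] := zeta ^+ n.-1 / rcont rad zeta theta x ^+ n.

Lemma cbmeas_markov_kernel theta zeta : sphere theta -> exterior rad zeta ->
  cbmeas D (fun x => markov_kernel zeta theta x).
Proof.
move=> th Ez; rewrite /markov_kernel; under eq_fun do rewrite -exprVn.
by apply: cbmeasM; [exact: cbmeas_cst|apply: cbmeasX; exact: cbmeas_rcontV].
Qed.

(** Linearity applies since the kernel is bounded on the ball, and the term
    P(zeta theta) cancels between the two transforms. *)
Lemma markov_second_kindB (mu : {finite_measure set T -> \bar R}) P theta zeta :
  sphere theta -> exterior rad zeta ->
  evalC P zeta theta * markov_transform rad mu zeta theta - second_kind rad mu P zeta theta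
  = ((omega R n)%:C)^-1 *
    Cintegral mu D (fun x => evalR P x * markov_kernel zeta theta x).
Proof.
move=> th Ez; have bK := cbmeas_markov_kernel th Ez.
have bPK : cbmeas D (fun x => evalR P x * markov_kernel zeta theta x).
  exact: cbmeasM (cbmeas_evalR P) bK.
have mD := @cball_borel R n rad.
rewrite /markov_transform /second_kind mulrCA -mulrBr -(CintegralZ mu mD _ bK); congr (_ * _).
have -> : (fun x => (evalC P zeta theta - evalR P x) / rcont rad zeta theta x ^+ n * zeta ^+ n.-1)
   = (fun x => evalC P zeta theta * markov_kernel zeta theta x +
       (-1) * (evalR P x * markov_kernel zeta theta x)).
  by apply/funext => x; rewrite /markov_kernel; ring.
rewrite (CintegralD mu mD) ?(CintegralZ mu mD _ bPK); last 2 first.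
- exact: cbmeasM (cbmeas_cst _ _) bK.
- exact: cbmeasM (cbmeas_cst _ _) bPK.
by rewrite opprD addNKr mulN1r opprK.
Qed.

End kernel.

(** * Null sets and the support *)

Section support.
Variables (R : realType) (n : nat).
Local Notation T := (borelRn R n).
Variable mu : {measure set T -> \bar R}.

Let rball (p : 'rV[rat]_n * nat) : set 'rV[R]_n := ball (map_mx ratr p.1 : 'rV[R]_n) (p.2.+1%:R^-1 : R).

(** Countably many balls with rational centres and radii cover the complement
    of the support by null sets. *)
Lemma msupport_compl_negligible : mu.-negligible (~` msupport mu).
Proof.
pose F (i : nat) : set T :=
  if @unpickle ('rV[rat]_n * nat)%type i is Some p then
    if pselect (mu (rball p) = 0%E) then rball p else set0
  else set0.
have F0 i : mu.-negligible (F i).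
  rewrite /F; case: unpickle => [p|]; last exact: negligible_set0.
  case: pselect => [mu0|_] /=; last exact: negligible_set0.
  by exists (rball p); split => //; apply: open_borel; apply: ball_open; rewrite invr_gt0.
apply: negligibleS (negligible_bigcup F0) => x nx.
have [U [oU Ux mU]] : exists U, [/\ open U, U x & mu U = 0%E].
  apply: contrapT => nU; apply: nx => U oU Ux; rewrite lt0e measure_ge0 andbT.
  by apply/eqP => mU; apply: nU; exists U.
have [e /= e0 eU] : nbhs_ball x U by apply/nbhs_ballP; exact: open_nbhs_nbhs.
have [k ke] : exists k : nat, 2 * k.+1%:R^-1 < e.
  exists (Num.truncn (2 / e)); rewrite ltr_pdivrMr // mulrC -ltr_pdivrMr //.
  exact: truncnS_gt.
have k0 : 0 < k.+1%:R^-1 :> R by rewrite invr_gt0.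
set dk : R := k.+1%:R^-1 in ke k0 *.
have qx i : exists q : rat, ratr q \in `](x 0 i - dk), (x 0 i + dk)[.
  by have [|q] := @rat_in_itvoo R (x 0 i - dk) (x 0 i + dk); [by rewrite ltrBlDr -addrA ltrDl addr_gt0|exists q].
have [c cx] := choice qx.
have cE (i : 'I_1) j : `|(map_mx ratr (\row_j c j)) i j - x i j| < dk.
  rewrite !mxE (ord1 i); move: (cx j); rewrite in_itv /= => /andP[? ?].
  by rewrite ltr_distl; apply/andP; split; lra.
have bx : rball (\row_j c j, k) x by split => // i j; exact: cE.
have bU : rball (\row_j c j, k) `<=` U.
  move=> y [_ yb]; apply: eU; split => // i j.
  have := yb i j; have := cE i j; rewrite /ball /= => h1 h2.
  rewrite (le_lt_trans (ler_distD ((map_mx ratr (\row_j c j)) i j) _ _)) //.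
  rewrite (distrC (x i j)); have {}h2 := lt_le_trans h2 (lexx dk); have := ltrD h1 h2.
  by move=> /lt_trans; apply; lra.
have mb : mu (rball (\row_j c j, k)) = 0%E.
  apply/eqP; rewrite -measure_le0 -mU le_measure ?inE //; apply: open_borel => //.
  by apply: ball_open.
exists (pickle (\row_j c j, k)) => //.
by rewrite /F pickleK; case: pselect.
Qed.

End support.

Section vanish.
Context d (T : measurableType d) (R : realType).
Variables (mu : {finite_measure set T -> \bar R}) (D : set T).
Hypothesis mD : measurable D.

Lemma Cintegral_ae0 (u : T -> R[i]) : cbmeas D u ->
  {ae mu, forall x, D x -> u x = 0} -> Cintegral mu D u = 0.
Proof.
move=> [[mr _] [mi _]] u0.
have Z (f : T -> R) : measurable_fun D f -> {ae mu, forall x, D x -> f x = 0} ->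
    Rintegral mu D f = 0.
  move=> mf f0; rewrite /Rintegral (ae_eq_integral (cst 0%E)) ?integral0 //.
  - exact/measurable_EFinP.
  - by apply: filterS f0 => x f0 Dx; rewrite f0.
rewrite /Cintegral !Z //; apply: filterS u0 => x u0 Dx; by rewrite u0.
Qed.

End vanish.

(** * Potentials vanishing outside a ball *)

Section euclid.
Variables (R : realType) (n : nat).
Implicit Types (x y : 'rV[R]_n).

Lemma cauchy_schwarz (a b : 'I_n -> R) :
  (\sum_i a i * b i) ^+ 2 <= (\sum_i a i ^+ 2) * (\sum_i b i ^+ 2).
Proof.
set A := \sum_i a i ^+ 2; set B := \sum_i b i ^+ 2; set C := \sum_i a i * b i.
have A0 : 0 <= A by rewrite sumr_ge0 // => i _; exact: sqr_ge0.
have [Az|An] := eqVneq A 0.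
  rewrite Az mul0r /C big1 ?expr0n // => i _.
  have /eqP : a i ^+ 2 = 0.
    by apply/eqP; move/eqP: Az; rewrite psumr_eq0 => [/allP/(_ i)|j _]; [apply; exact: mem_index_enum|exact: sqr_ge0].
  by rewrite sqrf_eq0 => /eqP ->; rewrite mul0r.
have {}An : 0 < A by rewrite lt_def An.
have expand (u v : R) : \sum_i (u * b i - v * a i) ^+ 2 = u ^+ 2 * B - 2 * u * v * C + v ^+ 2 * A.
  rewrite /A /B /C !mulr_sumr -sumrB -big_split /=; apply: eq_bigr => i _; ring.
have : 0 <= \sum_i (A * b i - C * a i) ^+ 2 by rewrite sumr_ge0 // => i _; exact: sqr_ge0.
rewrite expand => h; rewrite -(ler_pM2l An) -subr_ge0.
by rewrite (_ : _ - _ = A ^+ 2 * B - 2 * A * C * C + C ^+ 2 * A) //; ring.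
Qed.

Lemma enormD x y : enorm (x + y) <= enorm x + enorm y.
Proof.
rewrite -(@ler_pXn2r _ 2) ?nnegrE ?addr_ge0 ?enorm_ge0 // sqrrD !enorm_sq.
have -> : \sum_i (x + y) 0 i ^+ 2 = \sum_i x 0 i ^+ 2 + (\sum_i x 0 i * y 0 i) *+ 2 + \sum_i y 0 i ^+ 2.
  by rewrite -sumrMnl -!big_split /=; apply: eq_bigr => i _; rewrite mxE; ring.
rewrite lerD2r lerD2l lerMn2r /= (le_trans (ler_norm _)) //.
rewrite -(@ler_pXn2r _ 2) ?nnegrE ?mulr_ge0 ?enorm_ge0 ?normr_ge0 //.
by rewrite real_normK ?num_real // exprMn !enorm_sq cauchy_schwarz.
Qed.

Lemma enormN x : enorm (- x) = enorm x.
Proof. by rewrite /enorm; congr Num.sqrt; apply: eq_bigr => i _; rewrite mxE sqrrN. Qed.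

Lemma enorm_shift y x i (t : R) : enorm (y + t *: delta_mx 0 i - x) =
  Num.sqrt (\sum_j (y 0 j - x 0 j) ^+ 2 + 2 * t * (y 0 i - x 0 i) + t ^+ 2).
Proof.
rewrite /enorm; congr Num.sqrt.
rewrite (bigD1 i) //= [in RHS](bigD1 i) //= !mxE !eqxx /= mulr1.
rewrite (eq_bigr (fun j => (y 0 j - x 0 j) ^+ 2)) => [|j ji]; first by ring.
by rewrite !mxE eqxx (negPf ji) mulr0 addr0.
Qed.

Lemma enorm_delta i (t : R) : enorm (t *: delta_mx 0 i : 'rV[R]_n) = `|t|.
Proof.
rewrite -sqrtr_sqr /enorm; congr Num.sqrt.
rewrite (bigD1 i) //= !mxE !eqxx mulr1 big1 ?addr0 // => j ji.
by rewrite !mxE (negPf ji) andbF mulr0 expr0n.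
Qed.

(** For N = |y - x|^2 and d = y_i - x_i this is the derivative in t of
    |y + t e_i - x|^(-s) (y_i + t - x_i)^k; the cases k = 0 and k = 1 give the
    first and second derivatives of |y - x|^(-s). *)
Lemma is_derive_riesz (N d t : R) (s k : nat) : 0 < N + 2 * t * d + t ^+ 2 ->
  is_derive t 1
    (fun t => (Num.sqrt (N + 2 * t * d + t ^+ 2) ^+ s)^-1 * (d + t) ^+ k)
    (- s%:R * ((Num.sqrt (N + 2 * t * d + t ^+ 2) ^+ s.+2)^-1 * (d + t) ^+ k.+1)
     + k%:R * ((Num.sqrt (N + 2 * t * d + t ^+ 2) ^+ s)^-1 * (d + t) ^+ k.-1)).
Proof.
move=> Q0; set e := Num.sqrt (N + 2 * t * d + t ^+ 2).
have e0 : e != 0 by rewrite gt_eqF // sqrtr_gt0.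
have dQ : is_derive t 1 (fun t => N + 2 * t * d + t ^+ 2) (2 * (d + t)).
  have i1 : is_derive t (1 : R) (id : R -> R) 1 by exact: is_derive_id.
  have := is_deriveD (is_deriveD (is_derive_cst N t (1 : R)) (is_deriveZ (2 * d) i1)) (is_deriveX 2 i1).
  set F := (X in is_derive _ _ X _) => H.
  have -> : (fun t => N + 2 * t * d + t ^+ 2) = F.
    by apply/funext => u; rewrite /F -[RHS]/(N + (2 * d) * u + u * u); ring.
  by apply: (is_derive_eq H); rewrite add0r /GRing.scale /= expr1; ring.
have dS : is_derive t 1 (fun t => Num.sqrt (N + 2 * t * d + t ^+ 2)) ((d + t) / e).
  have := @is_derive1_comp _ Num.sqrt (fun t => N + 2 * t * d + t ^+ 2) t _ _ (is_derive1_sqrt Q0) dQ.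
  move=> H; apply: (is_derive_eq H); rewrite -/e; field; exact: e0.
have dE : is_derive t 1 ((fun t => Num.sqrt (N + 2 * t * d + t ^+ 2)) ^+ s) _ := is_deriveX s dS.
have dV := is_deriveV (f := (fun t => Num.sqrt (N + 2 * t * d + t ^+ 2)) ^+ s) _ dE.
have dL : is_derive t 1 (fun t => d + t) 1.
  have -> : (fun t => d + t) = cst d + (id : R -> R) by apply/funext.
  by apply: is_derive_eq; rewrite add0r.
have dK := is_deriveX k dL.
have fX (f : R -> R) m u : (f ^+ m) u = f u ^+ m.
  by elim: m => [|m IH]; rewrite ?expr0 // !exprS -IH.
have eS : ((fun t => Num.sqrt (N + 2 * t * d + t ^+ 2)) ^+ s) t != 0.
  by rewrite fX expf_neq0.
have := is_deriveM (dV eS) dK; set F := (X in is_derive _ _ X _) => H.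
have -> : (fun t => (Num.sqrt (N + 2 * t * d + t ^+ 2) ^+ s)^-1 * (d + t) ^+ k) = F.
  by apply/funext => u; rewrite /F [RHS]/(_ * _) !fX.
apply: (is_derive_eq H); rewrite !fX -/e -![_ *: _]/(_ * _).
clear H F eS dE dV dS dQ dL dK.
case: s => [|s]; first by rewrite mulr0n !mul0r !mulr0 oppr0 mul0r add0r addr0 mulr1; ring.
by rewrite /= !exprS; field; rewrite e0 expf_neq0 //.
Qed.

Definition riesz (s : nat) y x : R := (enorm (y - x) ^+ s)^-1.

Lemma enorm_le_diff (rad : R) x y : cball rad x -> enorm y - rad <= enorm (y - x).
Proof.
by move=> xr; have := enormD (y - x) x; rewrite subrK /cball /= in xr *; lra.
Qed.

Variables (rad : R) (mu : {finite_measure set (borelRn R n) -> \bar R}).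
Local Notation T := (borelRn R n).
Local Notation D := (cball rad : set T).

Lemma bmeas_riesz s y : rad < enorm y -> bmeas D (fun x => riesz s y x).
Proof.
move=> yr; have yr0 : 0 < enorm y - rad by rewrite subr_gt0.
split.
  apply: measurable_fun_inv => [|x _]; last by rewrite exprn_ge0 ?enorm_ge0.
  by apply: measurable_funX; apply: measurable_funTS; exact: enorm_borel.
exists ((enorm y - rad) ^+ s)^-1 => x xr.
have h := enorm_le_diff y xr.
have h0 : 0 < enorm (y - x) by lra.
rewrite /riesz ger0_norm ?invr_ge0 ?exprn_ge0 ?enorm_ge0 //.
by rewrite lef_pV2 ?posrE ?exprn_gt0 // lerXn2r // nnegrE ltW.
Qed.

Lemma bmeas_diff y i : bmeas D (fun x : 'rV[R]_n => y 0 i - x 0 i).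
Proof. by apply: bmeasD; [exact: bmeas_cst|apply: bmeasN; exact: bmeas_coord]. Qed.

(** Differentiation under the integral sign of an integral that vanishes on an
    open set of parameters.  For |t| < eta the point y + t e_i stays at
    distance at least eta from the ball, which bounds the derivative by the
    constant G. *)
Lemma riesz_derive0 (g : T -> R) s k i : bmeas D g ->
  (forall y, rad < enorm y ->
    Rintegral mu D (fun x => riesz s y x * (y 0 i - x 0 i) ^+ k * g x) = 0) ->
  forall y, rad < enorm y ->
    Rintegral mu D (fun x => (- s%:R * (riesz s.+2 y x * (y 0 i - x 0 i) ^+ k.+1)
      + k%:R * (riesz s y x * (y 0 i - x 0 i) ^+ k.-1)) * g x) = 0.
Proof.
move=> bg I0 y yr; have mD := @cball_borel R n rad.
pose eta := (enorm y - rad) / 2.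
have eta0 : 0 < eta by rewrite divr_gt0 // subr_gt0.
pose f (t : R) (x : T) : R := riesz s (y + t *: delta_mx 0 i) x *
  (y 0 i - x 0 i + t) ^+ k * g x.
have yt t : t \in `](- eta), eta[ -> rad + eta < enorm (y + t *: delta_mx 0 i).
  rewrite in_itv /= => /andP[t1 t2].
  have := enormD (y + t *: delta_mx 0 i) (- (t *: delta_mx 0 i)).
  rewrite addrK enormN enorm_delta.
  have : `|t| < eta by rewrite ltr_norml t1.
  by rewrite /eta; lra.
have coordt t x : (y + t *: delta_mx 0 i) 0 i - x 0 i = y 0 i - x 0 i + t.
  by rewrite !mxE !eqxx mulr1 addrAC.
have f0 t : t \in `](- eta), eta[ -> Rintegral mu D (f t) = 0.
  move=> tI; rewrite -[RHS](I0 (y + t *: delta_mx 0 i)); last by have := yt t tI; lra.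
  by apply: eq_Rintegral => x _; rewrite /f coordt.
have [_ [M' gM']] := bg; pose M := `|M'|.
have gM x : D x -> `|g x| <= M by move=> xD; exact: le_trans (gM' x xD) (ler_norm _).
pose L := enorm y + `|rad| + eta.
pose G := (s%:R * ((eta ^+ s.+2)^-1 * L ^+ k.+1) + k%:R * ((eta ^+ s)^-1 * L ^+ k.-1)) * M.
pose df t (x : T) := (- s%:R * (riesz s.+2 (y + t *: delta_mx 0 i) x * (y 0 i - x 0 i + t) ^+ k.+1)
      + k%:R * (riesz s (y + t *: delta_mx 0 i) x * (y 0 i - x 0 i + t) ^+ k.-1)) * g x.
have fD t x : t \in `](- eta), eta[ -> D x -> is_derive t 1 (f ^~ x) (df t x).
  move=> tI xD; pose N := \sum_j (y 0 j - x 0 j) ^+ 2.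
  have e0 : 0 < enorm (y + t *: delta_mx 0 i - x).
    by have := enorm_le_diff (y + t *: delta_mx 0 i) xD; have := yt t tI; lra.
  rewrite enorm_shift sqrtr_gt0 -/N in e0.
  have H := is_derive_riesz s k e0.
  have := is_deriveZ (g x) H; set F := (X in is_derive _ _ X _) => HM.
  have -> : f ^~ x = F.
    by apply/funext => u; rewrite /f /riesz enorm_shift -/N mulrC.
  by apply: (is_derive_eq HM); rewrite /df /riesz enorm_shift -/N /GRing.scale /= mulrC.
have I0' : (`](- eta), eta[%classic : set R) 0 by rewrite /= in_itv /= oppr_lt0 eta0.
have L0 : 0 <= L by rewrite /L !addr_ge0 ?enorm_ge0 ?normr_ge0 // ltW.
have M0 : 0 <= M by exact: normr_ge0.
have G0 : 0 <= G by rewrite /G mulr_ge0 // addr_ge0 // !mulr_ge0 // ?invr_ge0 ?exprn_ge0 // ltW.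
have intf t : (`](- eta), eta[%classic : set R) t -> mu.-integrable D (EFin \o f t).
  move=> tI; apply: bmeas_integrable => //; apply: bmeasM => //; apply: bmeasM.
    by apply: bmeas_riesz; have := yt t tI; lra.
  apply: bmeasX; apply: bmeasD; [exact: bmeas_diff|exact: bmeas_cst].
have derf t x : (`](- eta), eta[%classic : set R) t -> D x -> derivable (f ^~ x) t 1.
  by move=> tI xD; have [] := fD t x tI xD.
have dfE t x : (`](- eta), eta[%classic : set R) t -> D x -> partial1of2 f t x = df t x.
  by move=> tI xD; rewrite partial1of2E; have [_ ->] := fD t x tI xD.
have G_ub t x : (`](- eta), eta[%classic : set R) t -> D x -> `|partial1of2 f t x| <= G.
  move=> tI xD; rewrite dfE // /df /G normrM ler_pM ?normr_ge0 //; last exact: gM.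
  have e1 : eta <= enorm (y + t *: delta_mx 0 i - x).
    by have := enorm_le_diff (y + t *: delta_mx 0 i) xD; have := yt t tI; lra.
  have dL : `|y 0 i - x 0 i + t| <= L.
    rewrite (le_trans (ler_normD _ _)) // lerD //; last first.
      by move: tI; rewrite /= in_itv /= => /andP[t1 t2]; rewrite ler_norml !ltW.
    rewrite (le_trans (ler_normB _ _)) // lerD ?coord_le_enorm //.
    exact: le_trans (coord_le_enorm _ _) (le_trans xD (ler_norm _)).
  have rb m : `|riesz m (y + t *: delta_mx 0 i) x| <= (eta ^+ m)^-1.
    have e2 := lt_le_trans eta0 e1.
    rewrite /riesz ger0_norm ?invr_ge0 ?exprn_ge0 ?enorm_ge0 //.
    by rewrite lef_pV2 ?posrE ?exprn_gt0 // lerXn2r // nnegrE ltW.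
  have db m : `|(y 0 i - x 0 i + t) ^+ m| <= L ^+ m.
    by rewrite normrX lerXn2r // nnegrE.
  rewrite (le_trans (ler_normD _ _)) // lerD // !normrM.
    by rewrite normrN normr_nat ler_wpM2l // ler_pM.
  by rewrite normr_nat ler_wpM2l // ler_pM.
have intG : mu.-integrable D (EFin \o (fun=> G)).
  by apply: bmeas_integrable => //; exact: bmeas_cst.
have := differentiation_under_integral mD I0' intf derf (fun=> G0) intG G_ub.
rewrite derive1E (@near_eq_derive _ _ _ _ (cst 0)); last first.
  near=> t; apply: f0; near: t; exact: near_in_itvoo.
rewrite derive_cst => /esym; apply: etrans; apply: eq_Rintegral => x; rewrite inE => xD.
by rewrite dfE // /df scale0r !addr0.
Unshelve. all: by end_near.
Qed.

(** The exponent s is kept free because differentiation raises it. *)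
Definition potential0 (g : T -> R) s :=
  forall y, rad < enorm y -> Rintegral mu D (fun x => riesz s y x * g x) = 0.

Let mD : measurable D := @cball_borel R n rad.

Let intb (f : T -> R) : bmeas D f -> mu.-integrable D (EFin \o f).
Proof. exact: bmeas_integrable. Qed.

Lemma potential0_grad (g : T -> R) s i y : (0 < s)%N -> bmeas D g -> potential0 g s ->
  rad < enorm y -> Rintegral mu D (fun x => riesz s.+2 y x * (y 0 i - x 0 i) * g x) = 0.
Proof.
move=> s0 bg Hs yr.
have H0 z : rad < enorm z ->
    Rintegral mu D (fun x => riesz s z x * (z 0 i - x 0 i) ^+ 0 * g x) = 0.
  by move=> zr; rewrite -[RHS](Hs z zr); apply: eq_Rintegral => x _; rewrite expr0 mulr1.
have := riesz_derive0 bg H0 yr.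
have bu : bmeas D (fun x => riesz s.+2 y x * (y 0 i - x 0 i) * g x).
  by apply: bmeasM => //; apply: bmeasM; [exact: bmeas_riesz|exact: bmeas_diff].
rewrite (_ : (fun x => _) = (fun x => - s%:R * (riesz s.+2 y x * (y 0 i - x 0 i) * g x))).
  rewrite (RintegralZl _ mD (intb bu)) => /eqP.
  by rewrite mulf_eq0 oppr_eq0 pnatr_eq0 (gtn_eqF s0) => /eqP.
by apply/funext => x; rewrite mul0r addr0 expr1 !mulrA.
Qed.

Lemma riesz_sum s y x : rad < enorm y -> cball rad x ->
  \sum_i riesz s.+2 y x * (y 0 i - x 0 i) ^+ 2 = riesz s y x.
Proof.
move=> yr xr; rewrite -mulr_sumr /riesz.
have e0 : 0 < enorm (y - x) by have := enorm_le_diff y xr; lra.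
have -> : \sum_i (y 0 i - x 0 i) ^+ 2 = enorm (y - x) ^+ 2.
  by rewrite enorm_sq; apply: eq_bigr => i _; rewrite !mxE.
rewrite -addn2 exprD invfM mulfVK // expf_neq0 // gt_eqF //.
Qed.

(** Summing the second derivatives over the coordinates gives
    (n - (s + 2)) |y - x|^(-s-2), up to the factor -s; the constant is nonzero
    since s >= n. *)
Lemma potential0_laplace (g : T -> R) s : (0 < n <= s)%N -> bmeas D g ->
  potential0 g s -> potential0 g s.+2.
Proof.
move=> /andP[n0 ns] bg Hs y yr; have s0 : (0 < s)%N by exact: leq_trans ns.
have bR m : bmeas D (fun x => riesz m y x * g x).
  by apply: bmeasM => //; exact: bmeas_riesz.
have bR2 i : bmeas D (fun x => riesz s.+4 y x * (y 0 i - x 0 i) ^+ 2 * g x).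
  by apply: bmeasM => //; apply: bmeasM; [exact: bmeas_riesz|apply: bmeasX; exact: bmeas_diff].
have Hi i : s.+2%:R * Rintegral mu D (fun x => riesz s.+4 y x * (y 0 i - x 0 i) ^+ 2 * g x)
    = Rintegral mu D (fun x => riesz s.+2 y x * g x).
  have H1 z : rad < enorm z ->
      Rintegral mu D (fun x => riesz s.+2 z x * (z 0 i - x 0 i) ^+ 1 * g x) = 0.
    by move=> zr; rewrite -[RHS](potential0_grad i s0 bg Hs zr).
  have := riesz_derive0 bg H1 yr.
  rewrite (_ : (fun x => _) = (fun x => riesz s.+2 y x * g x -
      s.+2%:R * (riesz s.+4 y x * (y 0 i - x 0 i) ^+ 2 * g x))); last first.
    by apply/funext => x; rewrite expr0; ring.
  rewrite RintegralB //; [|exact: intb|]; last first.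
    by apply: intb; apply: bmeasM => //; exact: bmeas_cst.
  rewrite RintegralZl //; last exact: intb.
  by move/eqP; rewrite subr_eq0 => /eqP.
have sumE : Rintegral mu D (fun x => riesz s.+2 y x * g x) =
    \sum_i Rintegral mu D (fun x => riesz s.+4 y x * (y 0 i - x 0 i) ^+ 2 * g x).
  have -> : \sum_i Rintegral mu D (fun x => riesz s.+4 y x * (y 0 i - x 0 i) ^+ 2 * g x) =
      Rintegral mu D (fun x => \sum_i riesz s.+4 y x * (y 0 i - x 0 i) ^+ 2 * g x).
    elim: (index_enum _) => [|i r IH].
      rewrite big_nil; under eq_Rintegral do rewrite big_nil.
      by rewrite Rintegral_cst // mul0r.
    rewrite big_cons IH -RintegralD //; [|exact: intb|]; last first.
      by apply: intb; exact: bmeas_sum.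
    by apply: eq_Rintegral => x _; rewrite big_cons.
  apply: eq_Rintegral => x; rewrite inE => xr.
  by rewrite -mulr_suml riesz_sum.
move: sumE Hi; set I := Rintegral _ _ _ => sumE Hi.
have : s.+2%:R * I = n%:R * I.
  rewrite {1}sumE mulr_sumr (eq_bigr (fun=> I)) => [|i _]; last exact: Hi.
  by rewrite sumr_const card_ord mulr_natl.
move/eqP; rewrite -subr_eq0 -mulrBl mulf_eq0 subr_eq0 eqr_nat => /orP[/eqP sn|/eqP //].
by move: ns; rewrite -sn ltnNge leqnSn.
Qed.

(** The gradient of the potential has the factor y_i - x_i, and the part with
    the constant y_i vanishes by potential0_laplace. *)
Lemma potential0_coord (g : T -> R) s i : (0 < n <= s)%N -> bmeas D g ->
  potential0 g s -> potential0 (fun x => x 0 i * g x) s.+2.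
Proof.
move=> ns bg Hs y yr; have s0 : (0 < s)%N by case/andP: ns => n0; exact: leq_trans.
have bR : bmeas D (fun x => riesz s.+2 y x * g x).
  by apply: bmeasM => //; exact: bmeas_riesz.
have := potential0_grad i s0 bg Hs yr.
rewrite (_ : (fun x => _) = (fun x => y 0 i * (riesz s.+2 y x * g x) -
   riesz s.+2 y x * (x 0 i * g x))); last by apply/funext => x; ring.
rewrite RintegralB //; last 2 first.
- by apply: intb; apply: bmeasM => //; exact: bmeas_cst.
- apply: intb; apply: bmeasM; first exact: bmeas_riesz.
  by apply: bmeasM => //; exact: bmeas_coord.
rewrite RintegralZl //; last exact: intb.
rewrite (potential0_laplace ns bg Hs yr) mulr0 sub0r => /eqP.
by rewrite oppr_eq0 => /eqP.
Qed.

Lemma potential0_laplace_iter (g : T -> R) j : (0 < n)%N -> bmeas D g ->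
  potential0 g n -> potential0 g (n + j.*2).
Proof.
move=> n0 bg Hn; elim: j => [|j IH]; first by rewrite addn0.
rewrite doubleS !addnS; apply: potential0_laplace => //.
by rewrite n0 leq_addr.
Qed.

(** Each multiplication by a coordinate costs two units of the exponent; the
    induction therefore carries vanishing for all sufficiently large exponents
    of the parity of n, so that sums can be taken at a common exponent. *)
Lemma potential0_polyn (g : T -> R) P : (0 < n)%N -> bmeas D g -> potential0 g n ->
  (exists j, potential0 (fun x => Re (evalR P x) * g x) (n + j.*2)) /\
  (exists j, potential0 (fun x => Im (evalR P x) * g x) (n + j.*2)).
Proof.
move=> n0 bg Hn.
pose Z (f : 'rV[R]_n -> R) := bmeas D (f : T -> R) /\
  exists j0, forall j, (j0 <= j)%N -> potential0 (fun x => f x * g x) (n + j.*2).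
suff [[_ [j Hj]] [_ [k Hk]]] : Z (fun x => Re (evalR P x)) /\ Z (fun x => Im (evalR P x)).
  by split; [exists j; exact: Hj|exists k; exact: Hk].
apply: evalR_ind.
- split; first exact: bmeas_cst.
  exists 0%N => j _; under eq_fun do rewrite mul1r.
  exact: potential0_laplace_iter.
- move=> f h [bf [j Hj]] [bh [k Hk]]; split; first exact: bmeasD.
  exists (maxn j k) => m; rewrite geq_max => /andP[jm km] y yr.
  under eq_Rintegral do rewrite mulrDl mulrDr.
  rewrite RintegralD // ?Hj ?Hk ?addr0 //; apply: intb.
    by apply: bmeasM; [exact: bmeas_riesz|exact: bmeasM].
  by apply: bmeasM; [exact: bmeas_riesz|exact: bmeasM].
- move=> c f [bf [j Hj]]; split; first by apply: bmeasM => //; exact: bmeas_cst.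
  exists j => m jm y yr.
  rewrite (_ : (fun x => _) = (fun x => c * (riesz (n + m.*2) y x * (f x * g x)))); last first.
    by apply/funext => x; ring.
  rewrite RintegralZl // ?Hj ?mulr0 //; apply: intb.
  by apply: bmeasM; [exact: bmeas_riesz|exact: bmeasM].
- move=> i f [bf [j Hj]]; split; first by apply: bmeasM => //; exact: bmeas_coord.
  exists j.+1 => -[//|m] jm; rewrite doubleS !addnS.
  under eq_fun do rewrite -mulrA.
  apply: potential0_coord; [by rewrite n0 leq_addr|exact: bmeasM|exact: Hj].
Qed.

(** The kernel is positive on the ball. *)
Lemma potential0_ae0 (g : T -> R) s y : bmeas D g -> rad < enorm y ->
  Rintegral mu D (fun x => riesz s y x * (g x * g x)) = 0 ->
  {ae mu, forall x, D x -> g x = 0}.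
Proof.
move=> bg yr I0.
pose f x := riesz s y x * (g x * g x).
have bf : bmeas D f by apply: bmeasM; [exact: bmeas_riesz|exact: bmeasM].
have fi := intb bf.
have f0 x : 0 <= f x.
  by rewrite /f mulr_ge0 ?invr_ge0 ?exprn_ge0 ?enorm_ge0 // -expr2 sqr_ge0.
have J0 : (\int[mu]_(x in D) `|(f x)%:E| = 0)%E.
  under eq_integral do rewrite abse_EFin ger0_norm //.
  by rewrite -(fineK (integrable_fin_num mD fi)) -[fine _]/(Rintegral mu D f) I0.
have mf : measurable_fun D (EFin \o f) by apply/measurable_EFinP; case: bf.
have := ae_eq_integral_abs mu mD mf; rewrite /= J0 => -[/(_ erefl) h _].
apply: filterS h => x h xD; have := h xD => -[/eqP]; rewrite /f mulf_eq0 => /orP[|].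
  rewrite invr_eq0 expf_eq0 => /andP[_ /eqP e0].
  by have := enorm_le_diff y xD; rewrite e0; lra.
by rewrite mulf_eq0 orbb => /eqP.
Qed.

End euclid.

(** * The surface area of the sphere is nonzero *)

Section product_integration.
Variables (R : realType) (n : nat).
Local Notation leb := (@lebesgue_measure R).

(** The coordinates of index less than m are already integrated out. *)
Let hybrid (u : 'I_n -> R -> R) (U : 'I_n -> R) (m : nat) (x : 'I_n -> R) : R :=
  \prod_(i < n) (if (i < m)%N then U i else u i (x i)).

(** A pointwise inequality between products of functions of one variable is
    integrated one coordinate at a time; with indicators of intervals this says
    that boxes covering a box have at least its volume. *)
Lemma prod_le_series_integral (u : 'I_n -> R -> R) (U : 'I_n -> R)
    (v : nat -> 'I_n -> R -> R) (V : nat -> 'I_n -> R) :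
  (forall i t, 0 <= u i t) -> (forall k i t, 0 <= v k i t) ->
  (forall i, 0 <= U i) -> (forall k i, 0 <= V k i) ->
  (forall i, measurable_fun setT (u i)) -> (forall k i, measurable_fun setT (v k i)) ->
  (forall i, (\int[leb]_t (u i t)%:E = (U i)%:E)%E) ->
  (forall k i, (\int[leb]_t (v k i t)%:E = (V k i)%:E)%E) ->
  (forall x : 'I_n -> R,
     ((\prod_i u i (x i))%:E <= \sum_(0 <= k <oo) (\prod_i v k i (x i))%:E)%E) ->
  ((\prod_i U i)%:E <= \sum_(0 <= k <oo) (\prod_i V k i)%:E)%E.
Proof.
move=> u0 v0 U0 V0 mu mv iu iv uv.
suff H (m : nat) : (m <= n)%N -> forall x, ((hybrid u U m x)%:E <=
    \sum_(0 <= k <oo) (hybrid (v k) (V k) m x)%:E)%E.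
  have := H n (leqnn n) (fun=> 0).
  have E (w : 'I_n -> R -> R) W : hybrid w W n (fun=> 0) = \prod_i W i.
    by apply: eq_bigr => i _; rewrite ltn_ord.
  by under eq_eseriesr do rewrite E; rewrite E.
elim: m => [_ x|m IH mn x].
  have E (w : 'I_n -> R -> R) W : hybrid w W 0 x = \prod_i w i (x i) by [].
  by under eq_eseriesr do rewrite E; rewrite E.
pose i0 := Ordinal mn.
pose x' (t : R) : 'I_n -> R := fun i => if i == i0 then t else x i.
pose rest (w : 'I_n -> R -> R) (W : 'I_n -> R) : R :=
  \prod_(i < n | i != i0) (if (i < m)%N then W i else w i (x i)).
have hE (w : 'I_n -> R -> R) W t : hybrid w W m (x' t) = rest w W * w i0 t.
  rewrite /hybrid (bigD1 i0) //= ltnn /x' eqxx mulrC; congr (_ * _).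
  by apply: eq_bigr => i /negPf ii0; rewrite ii0.
have hS (w : 'I_n -> R -> R) W : hybrid w W m.+1 x = rest w W * W i0.
  rewrite /hybrid (bigD1 i0) //= ltnSn mulrC; congr (_ * _).
  apply: eq_bigr => i ii0; rewrite ltnS leq_eqVlt.
  by have /negPf -> : (i != m :> nat) by rewrite -(inj_eq val_inj) in ii0.
have rest0 (w : 'I_n -> R -> R) (W : 'I_n -> R) : (forall i t, 0 <= w i t) -> (forall i, 0 <= W i) -> 0 <= rest w W.
  by move=> w0 W0; apply: prodr_ge0 => i _; case: ifP.
have mh (w : 'I_n -> R -> R) W : measurable_fun setT (w i0) -> measurable_fun setT (fun t => (hybrid w W m (x' t))%:E).
  move=> mw; apply/measurable_EFinP; under eq_fun do rewrite hE.
  by apply: measurable_funM => //; exact: measurable_cst.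
have h0 (w : 'I_n -> R -> R) (W : 'I_n -> R) t : (forall i t, 0 <= w i t) -> (forall i, 0 <= W i) ->
    (0 <= (hybrid w W m (x' t))%:E)%E.
  by move=> w0 W0; rewrite hE lee_fin mulr_ge0 ?rest0.
have ih (w : 'I_n -> R -> R) (W : 'I_n -> R) : (forall i t, 0 <= w i t) -> (forall i, 0 <= W i) ->
    measurable_fun setT (w i0) -> (\int[leb]_t (w i0 t)%:E = (W i0)%:E)%E ->
    (\int[leb]_t (hybrid w W m (x' t))%:E = (hybrid w W m.+1 x)%:E)%E.
  move=> w0 W0 mw iw; under eq_integral do rewrite hE EFinM.
  rewrite ge0_integralZl_EFin ?rest0 //; last 2 first.
  - by move=> t _; rewrite lee_fin.
  - exact/measurable_EFinP.
  by rewrite iw -EFinM hS.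
rewrite -ih //; under eq_eseriesr => k _ do rewrite -ih //.
rewrite -integral_nneseries //; last 2 first.
- by move=> k; apply: mh.
- by move=> k t _; apply: h0.
apply: ge0_le_integral => //.
- by move=> t _; apply: h0.
- exact: mh.
- by apply: ge0_emeasurable_sum => [k t _ _|k _]; [apply: h0|apply: mh].
- by move=> t _; apply: IH; exact: ltnW.
Qed.

End product_integration.

Section omega.
Variables (R : realType) (n : nat).
Local Notation A := ([set x : 'rV[R]_n |
  exists (t : R) theta, [/\ 0 < t < 1, sphere theta & x = t *: theta]]).

Lemma enormZ (t : R) (x : 'rV[R]_n) : enorm (t *: x) = `|t| * enorm x.
Proof.
rewrite /enorm -sqrtr_sqr -sqrtrM ?sqr_ge0 //; congr Num.sqrt.
by rewrite mulr_sumr; apply: eq_bigr => i _; rewrite mxE exprMn.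
Qed.

(** The cone below the sphere is the open unit ball without the origin. *)
Lemma punctured_ball (x : 'rV[R]_n) : 0 < enorm x < 1 -> A x.
Proof.
move=> /andP[x0 x1]; exists (enorm x), ((enorm x)^-1 *: x); split.
- by rewrite x0.
- by rewrite /sphere /= enormZ gtr0_norm ?invr_gt0 // mulVf // gt_eqF.
- by rewrite scalerA divff ?gt_eqF // scale1r.
Qed.

Lemma lebesgue_outer_ball_lty : (0 < n)%N -> (lebesgue_outer A < +oo)%E.
Proof.
move=> n0; pose a k : 'rV[R]_n := if k is 0%N then const_mx (-1) else 0.
pose b k : 'rV[R]_n := if k is 0%N then const_mx 1 else 0.
apply: (@le_lt_trans _ _ (\sum_(0 <= k <oo) (\prod_i (b k 0 i - a k 0 i))%:E)%E).
  apply: ereal_inf_lbound; exists a, b; split => //.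
  - by case=> [|k] i; rewrite !mxE //; lra.
  - move=> x [t [th [/andP[t0 t1] th1 ->]]]; exists 0%N => // i.
    have := coord_le_enorm (t *: th) i.
    rewrite enormZ th1 mulr1 (gtr0_norm t0) => h.
    have := le_lt_trans h t1; rewrite ltr_norml => h1.
    by rewrite /a /b /= ![const_mx _ _ _]mxE.
rewrite (@nneseries_split _ _ 0 1); last first.
  move=> [|k] _; rewrite lee_fin prodr_ge0 // => i _; rewrite /a /b !mxE ?subrr //.
rewrite [X in (_ + X)%E]eseries0 ?adde0 ?big_nat1 ?ltry //.
move=> [//|k] _ _; rewrite (bigD1 (Ordinal n0)) //= !mxE subrr mul0r //.
Qed.

(** The ball contains the cube [c, 2c]^n with c = 1 / (4n). *)
Lemma lebesgue_outer_ball_gt0 : (0 < n)%N -> (0 < lebesgue_outer A)%E.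
Proof.
move=> n0; pose c : R := (4 * n)%:R^-1.
have nR : 0 < n%:R :> R by rewrite ltr0n.
have c0 : 0 < c by rewrite invr_gt0 ltr0n muln_gt0.
apply: (@lt_le_trans _ _ (c ^+ n)%:E); first by rewrite lte_fin exprn_gt0.
apply: le_ereal_inf_tmp => _ [a [b [ab Acov ->]]].
pose u (i : 'I_n) : R -> R := \1_(`[c, 2 * c]).
pose v (k : nat) (i : 'I_n) : R -> R := \1_(`]a k 0 i, b k 0 i[).
have -> : c ^+ n = \prod_(i < n) c by rewrite prodr_const card_ord.
apply: (@prod_le_series_integral R n u (fun=> c) v (fun k i => b k 0 i - a k 0 i)).
- by move=> i t; rewrite /u indicE.
- by move=> k i t; rewrite /v indicE.
- by move=> _; exact: ltW.
- by move=> k i; rewrite subr_ge0.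
- by move=> i; exact: measurable_indic.
- by move=> k i; exact: measurable_indic.
- move=> i; rewrite integral_indic // setIT.
  apply: (etrans (lebesgue_measure_itv `[c, 2 * c])); rewrite /= lte_fin.
  by rewrite ltr_pMl // ltr1n -EFinB; congr _%:E; ring.
- move=> k i; rewrite integral_indic // setIT.
  apply: (etrans (lebesgue_measure_itv `]a k 0 i, b k 0 i[)); rewrite /= lte_fin.
  have := ab k i; rewrite le_eqVlt => /predU1P[->|->]; last by rewrite EFinB.
  by rewrite ltxx subrr.
move=> x.
have term0 k : (0 <= (\prod_i v k i (x i))%:E)%E.
  by rewrite lee_fin prodr_ge0 // => i _; rewrite /v indicE.
have [xK|[i xi]] : (forall i, x i \in `[c, 2 * c]) \/ exists i, x i \notin `[c, 2 * c].
  have [/forallP ?|/forallPn ?] := boolP [forall i, x i \in `[c, 2 * c]]; by [left|right].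
  have [k _ xk] : (\bigcup_k [set x | forall i, a k 0 i < x 0 i < b k 0 i]) (\row_i x i).
    apply/Acov/punctured_ball; apply/andP; split.
      apply: (@lt_le_trans _ _ `|(\row_i x i) 0 (Ordinal n0)|); last exact: coord_le_enorm.
      rewrite mxE normr_gt0; have := xK (Ordinal n0); rewrite in_itv /= => /andP[cx _].
      by rewrite gt_eqF // (lt_le_trans c0).
    rewrite -(@ltr_pXn2r _ 2) ?nnegrE ?enorm_ge0 // expr1n enorm_sq.
    apply: (@le_lt_trans _ _ (\sum_(i < n) (2 * c) ^+ 2)).
      apply: ler_sum => i _; rewrite mxE; have := xK i; rewrite in_itv /= => /andP[cx xc].
      by rewrite lerXn2r // nnegrE ?(le_trans _ cx) ?mulr_ge0 // ltW.
    rewrite sumr_const card_ord.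
    have -> : (2 * c) ^+ 2 *+ n = c.
      by rewrite -[LHS]mulr_natl /c natrM; field; rewrite gt_eqF.
    by rewrite /c invf_lt1 ?ltr0n ?muln_gt0 // ltr1n; lia.
  have -> : \prod_i u i (x i) = 1.
    by apply: big1 => i _; rewrite /u indicE mem_set //; exact: xK.
  rewrite (@nneseriesD1 _ _ k) //.
  have -> : \prod_i v k i (x i) = 1.
    apply: big1 => i _; rewrite /v indicE mem_set //= in_itv /=.
    by have := xk i; rewrite mxE.
  by rewrite leeDl // nneseries_ge0.
have -> : \prod_i u i (x i) = 0.
  by rewrite (bigD1 i) //= /u indicE memNset ?mul0r //=; exact/negP.
exact: nneseries_ge0.
Qed.

Lemma omega_neq0 : (0 < n)%N -> omega R n != 0.
Proof.
move=> n0; rewrite /omega /surface_area mulf_neq0 ?pnatr_eq0 -?lt0n //.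
rewrite gt_eqF // fine_gt0 // lebesgue_outer_ball_gt0 //=.
exact: lebesgue_outer_ball_lty.
Qed.

End omega.

(** * Conclusion *)

Section conclusion.
Variables (R : realType) (n : nat) (rad : R).
Local Notation T := (borelRn R n).
Local Notation D := (cball rad : set T).
Variable mu : {finite_measure set T -> \bar R}.
Hypothesis mu_ball : msupport mu `<=` cball rad.

Lemma continuous_evalR (P : mpoly.mpoly n R[i]) :
  continuous (fun x : 'rV[R]_n => Re (evalR P x)) /\
  continuous (fun x : 'rV[R]_n => Im (evalR P x)).
Proof.
apply: (@evalR_ind R n (fun f => continuous f)).
- exact: cst_continuous.
- by move=> f g cf cg x; exact: continuousD (cf x) (cg x).
- by move=> c f cf x; apply: continuousM (cf x); exact: cst_continuous.
- by move=> i f cf x; apply: continuousM (cf x); exact: coord_continuous.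
Qed.

(** The set where a continuous g is nonzero is open, and here null. *)
Lemma ae0_msupport (g : 'rV[R]_n -> R) : continuous g ->
  {ae mu, forall x, D x -> g x = 0} -> msupport mu `<=` [set x | g x = 0].
Proof.
move=> cg g0 x xS; apply: contrapT => /= gx.
have oU : open [set x | g x != 0].
  apply: (@open_comp _ _ g [set r | r != 0]) => [z _|]; first exact: cg.
  exact: open_neq.
have : (0 < mu [set x | g x != 0%R])%E by apply: xS => //=; exact/eqP.
have D0 : mu.-negligible (~` D).
  by apply: negligibleS (msupport_compl_negligible mu); apply: subsetC.
have := negligibleU g0 D0 => N.
rewrite (_ : mu _ = 0%E) ?ltxx //; apply: measure_negligible; first exact: open_borel.
apply: negligibleS N => z /= gz; have [zD|zD] := pselect (D z); last by right.
by left => /(_ zD) /eqP; exact/negP.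
Qed.

Lemma markov_kernel_ray (y x : 'rV[R]_n) : 0 < rad -> rad < enorm y -> cball rad x ->
  markov_kernel rad (enorm y)%:C ((enorm y)^-1 *: y) x =
  (enorm y ^+ n.-1 * riesz n y x)%:C.
Proof.
move=> rad0 yr xr; have y0 : 0 < enorm y by exact: lt_trans yr.
have th : sphere ((enorm y)^-1 *: y).
  by rewrite /sphere /= enormZ gtr0_norm ?invr_gt0 // mulVf // gt_eqF.
rewrite /markov_kernel rcont_real // scalerA divff ?gt_eqF // scale1r.
by rewrite /riesz rmorphM fmorphV !rmorphXn.
Qed.

Lemma markov_potential0 P : 0 < rad ->
  (forall (y : 'rV[R]_n), rad < enorm y ->
    Cintegral mu D (fun x => evalR P x * markov_kernel rad (enorm y)%:C ((enorm y)^-1 *: y) x) = 0) ->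
  potential0 rad mu (fun x => Re (evalR P x)) n /\
  potential0 rad mu (fun x => Im (evalR P x)) n.
Proof.
move=> rad0 I0; have mD := @cball_borel R n rad.
have ReE (z : R[i]) (r : R) : Re (z * r%:C) = r * Re z by rewrite ReM mulr0 subr0 mulrC.
have ImE (z : R[i]) (r : R) : Im (z * r%:C) = r * Im z by rewrite ImM mulr0 add0r mulrC.
have [bre bim] := cbmeas_evalR rad P.
have key (g : T -> R) y : bmeas D g -> rad < enorm y ->
    Rintegral mu D (fun x => enorm y ^+ n.-1 * riesz n y x * g x) = 0 ->
    Rintegral mu D (fun x => riesz n y x * g x) = 0.
  move=> bg yr; under eq_Rintegral do rewrite -mulrA.
  rewrite RintegralZl //; last first.
    by apply: bmeas_integrable => //; apply: bmeasM => //; exact: bmeas_riesz.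
  move/eqP; rewrite mulf_eq0 expf_eq0 gt_eqF ?andbF /= => [/eqP //|].
  exact: lt_trans yr.
split=> y yr; apply: key => //; move: (I0 y yr); rewrite /Cintegral => -[].
- move=> <- _; apply: eq_Rintegral => x; rewrite inE => xr.
  by rewrite markov_kernel_ray // ReE.
- move=> _ <-; apply: eq_Rintegral => x; rewrite inE => xr.
  by rewrite markov_kernel_ray // ImE.
Qed.

Lemma potential0_evalR P : (0 < n)%N -> 0 < rad ->
  potential0 rad mu (fun x => Re (evalR P x)) n ->
  potential0 rad mu (fun x => Im (evalR P x)) n ->
  msupport mu `<=` [set x | evalR P x = 0].
Proof.
move=> n0 rad0 HR HI; have [bre bim] := cbmeas_evalR rad P.
pose y : 'rV[R]_n := (rad + 1) *: delta_mx 0 (Ordinal n0).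
have yr : rad < enorm y.
  by rewrite enorm_delta ger0_norm ?ltrDl // addr_ge0 ?ltW.
have [[j Hj] _] := potential0_polyn P n0 bre HR.
have [_ [k Hk]] := potential0_polyn P n0 bim HI.
have re0 := potential0_ae0 bre yr (Hj y yr).
have im0 := potential0_ae0 bim yr (Hk y yr).
have [cre cim] := continuous_evalR P.
move=> x xS; have := ae0_msupport cre re0 xS; have := ae0_msupport cim im0 xS.
by rewrite /=; case: (evalR P x) => a b /= -> ->.
Qed.

End conclusion.

Theorem theorem13 (R : realType) (n : nat) (n_gt0 : (0 < n)%N)
    (rad : R) (rad_gt0 : 0 < rad)
    (mu : {finite_measure set (borelRn R n) -> \bar R})
    (mu_ball : msupport mu `<=` cball rad)
    (P : mpoly.mpoly n R[i]) :
  msupport mu `<=` [set x | evalR P x = 0] <->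
  (forall (theta : 'rV[R]_n) (zeta : R[i]),
     sphere theta -> rad%:C < `|zeta| ->
     evalC P zeta theta * markov_transform rad mu zeta theta
       = second_kind rad mu P zeta theta).
Proof.
have om0 : ((omega R n)%:C : R[i])^-1 != 0.
  by rewrite invr_eq0 (fmorph_eq0 (real_complex R)) omega_neq0.
split=> [suppP theta zeta th Ez|idP].
  apply/eqP; rewrite -subr_eq0 markov_second_kindB // Cintegral_ae0 ?mulr0 //.
  - exact: cball_borel.
  - exact: cbmeasM (cbmeas_evalR _ _) (cbmeas_markov_kernel rad_gt0 th Ez).
  - apply: negligibleS (msupport_compl_negligible mu) => x /= Px xS.
    by apply: Px => _; rewrite (suppP x xS) mul0r.
have [|HR HI] := @markov_potential0 R n rad mu P rad_gt0; last exact: potential0_evalR HR HI.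
move=> y yr; have y0 : 0 < enorm y by exact: lt_trans yr.
have th : sphere ((enorm y)^-1 *: y).
  by rewrite /sphere /= enormZ gtr0_norm ?invr_gt0 // mulVf // gt_eqF.
have Ez : exterior rad (enorm y)%:C by apply/exteriorP; rewrite normc_real gtr0_norm.
have := markov_second_kindB rad_gt0 mu P th Ez.
rewrite idP // subrr => /esym/eqP; rewrite mulf_eq0 (negPf om0) /= => /eqP //.
Qed.
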